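(* Let $X=\{X(t):t\in I\}$ be a real-valued process, where $I$ is a bounded interval of $\mathbb{R}$. Assume that there exist $u\in\mathbb{R}$ and $\epsilon>0$ such that: (a) the sample paths of $X$ are $C^1(I)$; (b) $\sup_{|v-u|<\epsilon}\mathbf{E}(N_v(I)^2)<\infty$; (c) the density of $X(t)$ at point $v$ is uniformly bounded for $t\in I$ and $|v-u|<\epsilon$. Then $$\mathbf{E}(N_u(I))=\lim_{\delta\to0}\frac1{2\delta}\int_I\mathbf{E}\big(|X'(t)|\,\mathbf{1}_{\{|X(t)-u|\le\delta\}}\big)\,dt.$$ Suppose in addition that $X'(t)$ has a finite expectation for every $t\in I$, and define, for $|v-u|<\epsilon$, $$R(v):=\int_I\mathbf{E}\big(|X'(t)|\,\big|\,X(t)=v\big)\,p_{X(t)}(v)\,dt.$$ Then the equality $\mathbf{E}(N_u(I))=\lim_{\delta\to0}\frac1{2\delta}\int_I\mathbf{E}\big(|X'(t)|\,\mathbf{1}_{\{|X(t)-u|\le\delta\}}\big)\,dt$ can be rewritten as $$\mathbf{E}(N_u(I))=\lim_{\delta\to0}\frac1{2\delta}\int_{u-\delta}^{u+\delta}R(v)\,dv.$$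
   Context: $N_v(I)=\#\{t\in I:X(t)=v\}$ is the number of crossings of level $v$ by $X$ on $I$. $p_{X(t)}$ denotes the density of $X(t)$. The conditional expectation $\mathbf{E}(|X'(t)|\mid X(t)=v)$ is defined for almost every level $v$. *)

(* Defs.v *)
From HB Require Import structures.
From mathcomp Require Import all_boot all_order all_algebra.
From mathcomp Require Import all_classical all_reals all_analysis.

Set Implicit Arguments.
Unset Strict Implicit.
Unset Printing Implicit Defensive.

Import Order.TTheory GRing.Theory Num.Theory.
Import numFieldNormedType.Exports.

Local Open Scope classical_set_scope.
Local Open Scope ring_scope.
Local Open Scope ereal_scope.

(* Difference quotients of f at t, along points of I other than t, so that
   derivatives at the endpoints of an interval I are one-sided. *)
Definition diff_quot_within (R : realType) (I : set R) (f : R -> R) (t : R) :=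
  ((f s - f t) / (s - t))%R @[s --> within I t^'].

Definition derive_within (R : realType) (I : set R) (f : R -> R) (t : R) : R :=
  lim (diff_quot_within I f t).

Definition C1_on (R : realType) (I : set R) (f : R -> R) : Prop :=
  (forall t, I t -> cvg (diff_quot_within I f t)) /\
  {within I, continuous (derive_within I f)}.

Definition crossings (R : realType) (I : set R) (f : R -> R) (v : R) : \bar R :=
  counting [set t | I t /\ f t = v].

Definition has_density (d : measure_display) (T : measurableType d)
    (R : realType) (P : probability T R) (Y : {RV P >-> R}) (p : R -> R)
    : Prop :=
  [/\ measurable_fun setT p,
      (forall x, (0 <= p x)%R) &
      forall A : set R, measurable A ->
        distribution P Y A = \int[@lebesgue_measure R]_(x in A) (p x)%:E].

(* v |-> e v is a version of v |-> E(Z | Y = v); it is determined up to a set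
   of levels that is null for the law of Y. *)
Definition is_cond_expectation (d : measure_display) (T : measurableType d)
    (R : realType) (P : probability T R) (Z : T -> R) (Y : {RV P >-> R})
    (e : R -> R) : Prop :=
  [/\ measurable_fun setT e,
      (distribution P Y).-integrable setT (EFin \o e) &
      forall B : set R, measurable B ->
        \int[P]_(w in Y @^-1` B) (Z w)%:E
        = \int[distribution P Y]_(v in B) (e v)%:E].

Section process.
Variables (d : measure_display) (T : measurableType d) (R : realType).
Variables (P : probability T R) (I : set R) (X : R -> {RV P >-> R}).

Definition process_crossings (v : R) (w : T) : \bar R :=
  crossings I (fun s => X s w) v.

Definition process_derive (t : R) (w : T) : R :=
  derive_within I (fun s => X s w) t.

(* R(v), computed from densities p t of X(t) and versions e t of
   v |-> E(|X'(t)| | X(t) = v). *)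
Definition rice_function (p e : R -> R -> R) (v : R) : \bar R :=
  \int[@lebesgue_measure R]_(t in I) (e t v * p t v)%:E.

End process.

(* Main.v *)
Require Import Defs.
From HB Require Import structures.
From mathcomp Require Import all_boot all_order all_algebra.
From mathcomp Require Import finmap ring lra.
From mathcomp Require Import all_classical all_reals all_analysis.
From mathcomp Require Import measurable_realfun.

(** Let [N_v] be the number of crossings of level [v].

    For one path [f], of class C1, the area formula says that the integral of
    [|f'|] over the times when [f] lies between [u - delta] and [u + delta] is the
    integral of [N_v] over the levels [v] in this range ([area_formula]). It
    follows by cutting time into small cells: on a cell where [f'] does not vanish
    it is the fundamental theorem of calculus, and on the others both sides are
    negligible. By Tonelli's theorem, the expression in the first limit is the
    average of [E N_v] over these levels ([expected_area]), so it is enough that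
    [v |-> E N_v] be continuous at [u].

    Almost surely, [N_v = N_u] for every [v] close enough to [u]
    ([negligible_not_locally_constant]). This is deterministic as soon as [N_u] is
    finite, [f'] does not vanish at the times when [f = u], and [f] keeps away from
    [u] near the ends of the interval ([crossings_locally_constant]). The first
    condition holds almost surely by the moment assumption; the second one by
    Bulinskaya's argument, from the bound on the densities
    ([negligible_critical]). For the third one, the interval may be open and the
    path may oscillate near its ends. If it came arbitrarily close to [u] there
    then, as it crosses the levels [u + eta] and [u - eta] finitely often, it would
    remain between them near this end, which for small [eta] has small probability
    ([negligible_boundary_left]). The uniform bound on the
    second moments of [N_v] then turns the almost sure statement into the
    continuity of the expectations ([expectation_near]).

    For the second limit, the density [p t] of [X t] turns the integral of
    [e t v * p t v] over a set of levels into that of [e t] for the law of [X t],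
    which is the expectation of [|X' t|] over the event that [X t] lies in this set.
    Exchanging the integrals in [t] and [v] shows that the two expressions are
    equal for each small [delta] ([integral_rice]). *)

Import Order.TTheory GRing.Theory Num.Theory.
Import numFieldNormedType.Exports.
Set Implicit Arguments.
Unset Strict Implicit.
Unset Printing Implicit Defensive.
Local Open Scope classical_set_scope.
Local Open Scope ring_scope.
Local Open Scope ereal_scope.

(** * Counting the points of a set of reals by grid cells *)

Lemma le_size_counting (T : choiceType) (R : realType) (A : set T) (s : seq T) :
  uniq s -> (forall x, x \in s -> A x) -> (size s)%:R%:E <= counting A :> \bar R.
Proof.
move=> us sA; rewrite /counting; case: ifPn => [/asboolP fA|_]; last by rewrite leey.
rewrite lee_fin ler_nat; apply: uniq_leq_size => // x /sA Ax.
by rewrite in_fset_set// inE.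
Qed.

Lemma counting_le_size (T : pointedType) (R : realType) (A : set T) (c : \bar R) :
  (forall s, uniq s -> (forall x, x \in s -> A x) -> (size s)%:R%:E <= c) ->
  counting A <= c.
Proof.
move=> h; rewrite /counting; case: ifPn => [/asboolP fA|/asboolP iA].
  by apply: h => [|x]; rewrite ?fset_uniq// in_fset_set// inE.
rewrite leye_eq; apply/eqP/eqyP => r r0.
move/infiniteP : iA => /pcard_leP/injfunPex [f fA fi].
have [n rn] : exists n : nat, (r <= n%:R)%R.
  by exists (Num.truncn r).+1; apply/ltW/truncnS_gt.
apply: (@le_trans _ _ n%:R%:E); first by rewrite lee_fin.
have := h (map f (iota 0 n)); rewrite size_map size_iota; apply.
  rewrite map_inj_uniq ?iota_uniq// => x y.
  by apply: fi; rewrite inE.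
by move=> x /mapP [k _ ->]; exact: fA.
Qed.

(** The two hypotheses sandwich [u] between the cardinals of the finite subsets
    of [A] and that of [A], so finite and infinite [A] are treated alike. *)
Lemma counting_cvg (T : pointedType) (R : realType) (A : set T) (u : nat -> \bar R) :
  (forall n, u n <= counting A) ->
  (forall s, uniq s -> (forall x, x \in s -> A x) ->
     \forall n \near \oo, (size s)%:R%:E <= u n) ->
  u n @[n --> \oo] --> counting A.
Proof.
move=> ule uge.
have [finA|iA] := pselect (finite_set A).
  have cE : counting A = (size (fset_set A))%:R%:E :> \bar R.
    by rewrite /counting asboolT.
  apply: cvg_near_cst; rewrite cE.
  have := uge (fset_set A) (fset_uniq _) _; rewrite cE in ule *.
  case=> [x|m _ um]; first by rewrite in_fset_set// inE.
  by exists m => // n mn; apply/eqP; rewrite eq_le ule um.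
rewrite [X in _ --> X](_ : _ = +oo); last by rewrite /counting asboolF.
apply/cvgeyPge => r.
move/infiniteP : iA => /pcard_leP/injfunPex [f fA fi].
have rn : (r <= (Num.truncn r).+1%:R)%R by apply/ltW/truncnS_gt.
have := uge (map f (iota 0 (Num.truncn r).+1)) _ _; rewrite size_map size_iota.
case=> [|x /mapP [k _ ->]|m _ um]; last 2 first.
- exact: fA.
- by exists m => // n mn; apply: le_trans (um n mn); rewrite lee_fin.
by rewrite map_inj_uniq ?iota_uniq// => x y; apply: fi; rewrite inE.
Qed.

Lemma near_all_seq (T : eqType) (U : Type) (F : set_system U) (FF : Filter F)
    (s : seq T) (Q : T -> U -> Prop) :
  (forall x, x \in s -> \forall y \near F, Q x y) ->
  \forall y \near F, forall x, x \in s -> Q x y.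
Proof.
elim: s => [|a s IH] h; first by apply: filterE => y x; rewrite in_nil.
have ha := h a (mem_head _ _).
have {}IH : \forall y \near F, forall x, x \in s -> Q x y.
  by apply: IH => x xs; apply: h; rewrite inE xs orbT.
by apply: filterS2 ha IH => y Qa Qs x; rewrite inE => /orP[/eqP->|/Qs].
Qed.

Lemma near_lt_mesh (R : realType) (l r : R) : (0 < r)%R ->
  \forall n \near \oo, (l / n.+1%:R < r)%R.
Proof.
move=> r0.
have /cvgrPdist_lt/(_ _ r0) : ((l * n.+1%:R^-1)%R @[n --> \oo] --> (0%R : R)).
  by rewrite -[X in _ --> X](mulr0 l : (l * 0)%R = 0%R); apply: cvgMr; exact: cvg_harmonic.
by apply: filterS => n; rewrite sub0r normrN; apply: le_lt_trans; exact: ler_norm.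
Qed.

Section grid.
Context {R : realType}.
Implicit Types (c d : R) (A : set R).

Definition gridpt c d n k : R := (c + (d - c) * (k%:R / n.+1%:R))%R.

Definition cell c d n k : set R := `[gridpt c d n k, gridpt c d n k.+1[%classic.

(** Number of cells that meet [A]; unlike the cardinal of a level set, it is a
    finite sum of indicators of sets with a simple description. *)
Definition hits c d n A : \bar R :=
  \sum_(k < n.+1) (`[< A `&` cell c d n k !=set0 >] : bool)%:R%:E.

Lemma gridptS c d n k :
  gridpt c d n k.+1 = (gridpt c d n k + (d - c) / n.+1%:R)%R.
Proof. by rewrite /gridpt -(natr1 k); ring. Qed.

Lemma gridpt0 c d n : gridpt c d n 0 = c.
Proof. by rewrite /gridpt mul0r mulr0 addr0. Qed.

Lemma gridpt_last c d n : gridpt c d n n.+1 = d.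
Proof. by rewrite /gridpt divff// mulr1 addrC subrK. Qed.

Lemma le_gridpt c d n i j : (c <= d)%R -> (i <= j)%N ->
  (gridpt c d n i <= gridpt c d n j)%R.
Proof.
move=> cd ij; rewrite lerD2l ler_wpM2l ?subr_ge0//.
by rewrite ler_wpM2r ?ler_nat// invr_ge0.
Qed.

Lemma gridpt_itv c d n k : (c <= d)%R -> (k <= n.+1)%N ->
  (c <= gridpt c d n k <= d)%R.
Proof.
move=> cd kn; have := le_gridpt n cd kn; have := le_gridpt n cd (leq0n k).
by rewrite gridpt0 gridpt_last => -> ->.
Qed.

Lemma cell_disj c d n i j x : (c <= d)%R ->
  cell c d n i x -> cell c d n j x -> i = j.
Proof.
move=> cd; wlog ij : i j / (i <= j)%N.
  by move=> h xi xj; have [ij|/ltnW ij] := leqP i j; [exact: h|apply: esym; exact: h].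
rewrite /cell /= !in_itv/= => /andP[_ xi] /andP[xj _].
apply: anti_leq; rewrite ij /= leqNgt; apply/negP => ji.
by move: (lt_le_trans xi (le_gridpt n cd ji)); rewrite ltNge xj.
Qed.

Lemma mem_cell c d n x : (c <= x < d)%R -> exists k : 'I_n.+1, cell c d n k x.
Proof.
move=> /andP[cx xd]; have cd : (0 < d - c)%R by rewrite subr_gt0 (le_lt_trans cx).
have [y [-> y0 yn]] : exists y, [/\ x = (c + (d - c) * (y / n.+1%:R))%R,
    (0 <= y)%R & (y < n.+1%:R)%R].
  exists ((x - c) / (d - c) * n.+1%:R)%R; split.
  - by rewrite mulfK// mulrCA divff ?gt_eqF// mulr1 addrC subrK.
  - by apply: mulr_ge0 => //; apply: divr_ge0; [rewrite subr_ge0|exact: ltW].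
  - by rewrite -[ltRHS]mul1r ltr_pM2r// ltr_pdivrMr// mul1r ltrD2r.
have kn : (Num.truncn y < n.+1)%N by rewrite truncn_lt_nat.
exists (Ordinal kn); rewrite /cell/= in_itv/= /gridpt.
rewrite lerD2l ltrD2l ler_pM2l// ltr_pM2l// ler_pM2r ?invr_gt0// ltr_pM2r ?invr_gt0//.
by rewrite truncn_le y0 truncnS_gt.
Qed.

Lemma cell_dist c d n k x y : cell c d n k x -> cell c d n k y ->
  (`|x - y| < (d - c) / n.+1%:R)%R.
Proof.
rewrite /cell/= !in_itv/= gridptS; move: (gridpt _ _ _ _) (_ / _)%R => g h.
move=> /andP[x1 x2] /andP[y1 y2].
by rewrite ltr_norml; apply/andP; split; lra.
Qed.

Lemma hitsE c d n A :
  hits c d n A =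
  (size [seq k : 'I_n.+1 <- enum 'I_n.+1 |
    `[< A `&` cell c d n k !=set0 >]])%:R%:E.
Proof.
rewrite /hits sumEFin -natr_sum size_filter -sum1_count big_enum_cond/=.
by rewrite [in RHS]big_mkcond; congr (_%:R%:E); apply: eq_bigr => k _; case: asbool.
Qed.

Lemma hits_ge0 c d n A : 0 <= hits c d n A.
Proof. by rewrite hitsE lee_fin. Qed.

(** Picking one point of [A] in each cell that meets it is injective, the cells
    being disjoint. *)
Lemma hits_le_counting c d n A : (c <= d)%R -> hits c d n A <= counting A.
Proof.
move=> cd; rewrite hitsE.
have [pt ptP] : exists pt : 'I_n.+1 -> R, forall k : 'I_n.+1,
    A `&` cell c d n k !=set0 -> A (pt k) /\ cell c d n k (pt k).
  exists (fun k : 'I_n.+1 => get (A `&` cell c d n k)) => k [x Ax].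
  exact: (getI Ax).
rewrite -(size_map pt); apply: le_size_counting.
  rewrite map_inj_in_uniq; [exact: (filter_uniq _ (enum_uniq _))|move=> i j].
  rewrite !mem_filter => /andP[/asboolP/ptP [_ +] _] /andP[/asboolP/ptP [_ +] _].
  by move=> + + eij; rewrite eij => h1 h2; apply/val_inj/(cell_disj cd h1 h2).
by move=> x /mapP [k]; rewrite mem_filter => /andP[/asboolP/ptP [? _] _] ->.
Qed.

(** Once the mesh is below the least distance between two of the points, they
    lie in distinct cells. *)
Lemma hits_ge_size c d A s : uniq s -> (forall x, x \in s -> A x) ->
    (forall x, x \in s -> (c <= x < d)%R) ->
  \forall n \near \oo, (size s)%:R%:E <= hits c d n A.
Proof.
move=> us sA scd.
have sep : \forall n \near \oo, forall x, x \in s -> forall y, y \in s ->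
    x != y -> ((d - c) / n.+1%:R <= `|x - y|)%R.
  apply: near_all_seq => x xs; apply: near_all_seq => y ys.
  have [->|xy] := eqVneq x y; first exact: nearW.
  have xy0 : (0 < `|x - y|)%R by rewrite normr_gt0 subr_eq0.
  by apply: filterS (near_lt_mesh (d - c) xy0) => n /ltW.
case: sep => m _ sep; exists m => // n mn; rewrite hitsE lee_fin ler_nat.
have [idx idxP] : exists idx : R -> 'I_n.+1, forall x, x \in s -> cell c d n (idx x) x.
  exists (fun x => xget ord0 [set k : 'I_n.+1 | cell c d n k x]) => x xs.
  have [k kx] := mem_cell n (scd x xs).
  exact: (@xgetI _ ord0 [set k : 'I_n.+1 | cell c d n k x] k).
rewrite -(size_map idx); apply: uniq_leq_size.
  rewrite map_inj_in_uniq// => x y xs ys exy; apply/eqP/negPn/negP => xy.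
  have := sep n mn x xs y ys xy; rewrite leNgt => /negP; apply.
  by apply: (@cell_dist _ _ _ (idx x)); [exact: idxP|rewrite exy; exact: idxP].
move=> _ /mapP [x xs ->]; rewrite mem_filter mem_enum andbT; apply/asboolP.
by exists x; split; [exact: sA|exact: idxP].
Qed.

Lemma hits_cvg c d A : (c <= d)%R -> A `<=` `[c, d[ ->
  hits c d n A @[n --> \oo] --> counting A.
Proof.
move=> cd Acd; apply: counting_cvg => [n|s us sA]; first exact: hits_le_counting.
by apply: hits_ge_size => // x /sA/Acd; rewrite /= in_itv.
Qed.

End grid.

(** * Continuously differentiable functions on an open interval *)

Section C1_open.
Context {R : realType}.
Local Open Scope ring_scope.
Implicit Types (a b c d x y v : R) (f g : R -> R).

(** The derivative is carried along as a function [g] since, for a path of the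
    process, it is a derivative relative to the index set. *)
Definition C1_oo a b f g :=
  (forall t, t \in `]a, b[ -> is_derive t (1 : R) f (g t)) /\
  (forall t, t \in `]a, b[ -> {for t, continuous g}).

Lemma C1_on_oo (I : set R) a b f : `]a, b[ `<=` I -> C1_on I f ->
  C1_oo a b f (derive_within I f).
Proof.
move=> abI [fd fc]; split=> t tab; last first.
  have /continuous_subspaceW/(_ fc) : `]a, b[ `<=` I by [].
  rewrite continuous_open_subspace; last exact: interval_open.
  by apply; rewrite inE.
have /cvgrPdist_lt H := fd t (abI t tab).
have L : h^-1 *: ((f \o shift t) (h *: 1) - f t) @[h --> 0^'] --> derive_within I f t.
  apply/cvgrPdist_lt => e e0; have := H e e0.
  have : \forall s \near t, s \in `]a, b[.
    by apply: open_nbhs_nbhs; split; [exact: interval_open|].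
  rewrite !near_withinE => /nbhs_ballP[r1 /= r10 B1] /nbhs_ballP[r2 /= r20 B2].
  apply/nbhs_ballP; exists (Num.min r1 r2) => /=; first by rewrite lt_min r10.
  move=> h; rewrite /ball/= sub0r normrN lt_min => /andP[h1 h2] h0.
  have := B2 (h + t); rewrite /ball/= opprD addrCA subrr addr0 normrN => /(_ h2).
  rewrite addrK -[h%:A]/(h * 1) mulr1 [_ *: _]mulrC; apply.
    by rewrite -subr_eq0 addrK.
  by apply/abI/B1; rewrite /ball/= opprD addrCA subrr addr0 normrN.
by apply: DeriveDef; [apply/cvg_ex; eexists; exact: L|apply/cvg_lim: L].
Qed.

Section props.
Variables (a b : R) (f g : R -> R).
Hypothesis fg : C1_oo a b f g.

Let sub_in c d x : a < c -> d < b -> x \in `[c, d] -> x \in `]a, b[.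
Proof. by move=> ac db; rewrite !in_itv/= => /andP[cx xd]; apply/andP; split; lra. Qed.

Lemma C1_oo_continuous x : x \in `]a, b[ -> {for x, continuous f}.
Proof.
by move=> /(proj1 fg) h; apply/differentiable_continuous/derivable1_diffP; exact: ex_derive.
Qed.

Lemma C1_oo_within c d : a < c -> d < b -> {within `[c, d], continuous f}.
Proof.
move=> ac db; apply: derivable_within_continuous => x /(sub_in ac db) xab.
by case: ((proj1 fg) x xab).
Qed.

Lemma C1_oo_within' c d : a < c -> d < b -> {within `[c, d], continuous g}.
Proof.
move=> ac db; apply: continuous_in_subspaceT => x /set_mem /(sub_in ac db).
exact: (proj2 fg).
Qed.

Lemma C1_oo_MVT c d : a < c -> d < b -> c <= d ->
  exists2 s, s \in `[c, d] & f d - f c = g s * (d - c).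
Proof.
move=> ac db cd; apply: MVT_segment => //; last exact: C1_oo_within.
by move=> x xcd; apply: (proj1 fg); apply: (sub_in ac db); exact: subset_itv_oo_cc.
Qed.

(** Heine's theorem on a segment, with one of the two points allowed to leave
    the segment. *)
Lemma C1_oo_unif c d (eta : R) : a < c -> d < b -> 0 < eta ->
  \forall r \near 0^'+, forall x y, x \in `[c, d] -> `|x - y| < r ->
    `|g x - g y| <= eta.
Proof.
move=> ac db eta0.
have /compact_near_coveringP cov := @segment_compact R c d.
have H := cov R (0^'+) (fun (r x : R) => forall y, `|x - y| < r -> `|g x - g y| <= eta) _.
have eta2 : 0 < eta / 2 by rewrite divr_gt0.
have {H} : \forall r \near (0 : R)^'+,
    `[c, d]%classic `<=` (fun x => forall y, `|x - y| < r -> `|g x - g y| <= eta).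
  apply: H => x xcd.
  have /cvgrPdist_lt/(_ _ eta2) : g z @[z --> x] --> g x.
    by apply: (proj2 fg); apply: (sub_in ac db).
  move=> /nbhs_ballP[rho /= rho0 B].
  exists (ball x (rho / 2), [set r | r < rho / 2]) => /=.
    split; first by apply: nbhsx_ballx; rewrite divr_gt0.
    by apply: nbhs_right_lt; rewrite divr_gt0.
  move=> [x' r] /= [xx' rrho] y x'y.
  have h1 : `|g x - g x'| < eta / 2.
    by apply: B; rewrite /ball/= (lt_trans xx')// ltr_pdivrMr// ltr_pMr// ltr1n.
  have h2 : `|g x - g y| < eta / 2.
    apply: B; rewrite /ball/=; apply: le_lt_trans (ler_distD x' _ _) _.
    by rewrite [ltRHS]splitr ltrD// (lt_trans x'y).
  apply/ltW; rewrite [ltRHS]splitr; apply: le_lt_trans (ler_distD (g x) _ _) _.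
  by rewrite ltrD// distrC.
by apply: filterS => r H x y xcd; exact: H.
Qed.

End props.
End C1_open.

(** * Pieces on which the derivative does not vanish *)

Section area.
Context {R : realType}.
Local Open Scope ring_scope.
Implicit Types (a b c d x y v p q : R) (f g : R -> R).
Local Notation mu := (@lebesgue_measure R).

Lemma C1_oo_opp a b f g : C1_oo a b f g -> C1_oo a b (fun t => - f t) (fun t => - g t).
Proof.
move=> [h1 h2]; split=> t tab; first by have := h1 t tab => ?; exact: is_deriveN.
by apply: continuousN; exact: h2.
Qed.

Lemma C1_oo_image_itv a b f g (J : set R) : C1_oo a b f g ->
  J `<=` `]a, b[ -> is_interval J -> is_interval (f @` J).
Proof.
move=> fg Jab iJ _ _ [s Js <-] [t Jt <-] v /andP[sv vt].
have sab := Jab _ Js; have tab := Jab _ Jt; rewrite /= !in_itv/= in sab tab.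
have mM : Num.min s t <= Num.max s t by rewrite ge_min le_max lexx.
have am : a < Num.min s t by rewrite lt_min; lra.
have Mb : Num.max s t < b by rewrite gt_max; lra.
have [|u /[!in_itv]/= uin fu] := IVT (v := v) mM (C1_oo_within fg am Mb).
  case: (leP s t) => st; rewrite ge_min le_max sv vt ?orbT//.
exists u => //; move: uin; case: (leP s t) => st ?; first exact: iJ Js Jt _ _.
exact: iJ Jt Js _ _.
Qed.

Lemma nonvanishing_sign a b f g x y : C1_oo a b f g -> a < x -> y < b ->
  (forall t, t \in `[x, y] -> g t != 0) ->
  (forall t, t \in `[x, y] -> 0 < g t) \/ (forall t, t \in `[x, y] -> g t < 0).
Proof.
move=> fg ax yb g0.
have [h|/existsNP [s /not_implyP [sxy /negP]]] :=
  pselect (forall t, t \in `[x, y] -> 0 < g t); first by left.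
rewrite -leNgt le_eqVlt (negbTE (g0 _ sxy))/= => gs; right=> t txy.
rewrite ltNge le_eqVlt eq_sym (negbTE (g0 _ txy))/=; apply/negP => gt.
move: sxy txy; rewrite !in_itv/= => xs xt.
have mM : Num.min s t <= Num.max s t by rewrite ge_min le_max lexx.
have am : a < Num.min s t by rewrite lt_min; lra.
have Mb : Num.max s t < b by rewrite gt_max; lra.
have [|u /[!in_itv]/= uin gu] := IVT (v := 0) mM (C1_oo_within' fg am Mb).
  case: (leP s t) => st; rewrite ge_min le_max !(ltW gs) !(ltW gt) ?orbT//.
suff /g0 : u \in `[x, y] by rewrite gu eqxx.
by rewrite in_itv/=; move: uin; case: (leP s t) => st ?; lra.
Qed.

Lemma C1_oo_increasing a b f g x y s t : C1_oo a b f g -> a < x -> y < b ->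
  (forall t, t \in `[x, y] -> 0 < g t) ->
  x <= s -> s < t -> t <= y -> f s < f t.
Proof.
move=> fg ax yb g0 xs st ty.
have [||u /[!in_itv]/= uin fst] := C1_oo_MVT fg _ _ (ltW st); try lra.
by rewrite -subr_gt0 fst mulr_gt0 ?subr_gt0//; apply: g0; rewrite in_itv/=; lra.
Qed.

(** Rolle's theorem. *)
Lemma nonvanishing_inj a b f g x y : C1_oo a b f g -> a < x -> y < b ->
  (forall t, t \in `[x, y] -> g t != 0) -> {in `[x, y] &, injective f}.
Proof.
move=> fg ax yb g0.
have H s t : s \in `[x, y] -> t \in `[x, y] -> s < t -> f s = f t -> False.
  rewrite !in_itv/= => /andP[xs sy] /andP[xt ty] st fst.
  have [||u /[!in_itv]/= uin] := C1_oo_MVT fg _ _ (ltW st); try lra.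
  rewrite fst subrr => /esym/eqP; rewrite mulf_eq0 => /orP[|/eqP ?]; last by lra.
  by apply/negP/g0; rewrite in_itv/=; lra.
move=> s t xs xt fst; case: (ltgtP s t) => // st; first by case: (H s t).
by case: (H t s).
Qed.

Section pieces.
Variables (a b : R) (f g : R -> R).
Hypothesis fg : C1_oo a b f g.

Lemma measurable_absd (D : set R) : D `<=` `]a, b[ -> measurable D ->
  measurable_fun D (fun t => `|g t|%:E).
Proof.
move=> Dab mD; apply/measurable_EFinP; apply: measurableT_comp => //.
apply: (measurable_funS _ Dab); first exact: measurable_itv.
apply: subspace_continuous_measurable_fun; first exact: measurable_itv.
by apply: continuous_in_subspaceT => x /set_mem; exact: (proj2 fg).
Qed.

Lemma measurable_preim (J B : set R) : J `<=` `]a, b[ -> measurable J ->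
  measurable B -> measurable (J `&` f @^-1` B).
Proof.
move=> Jab mJ mB; suff : measurable_fun J f by apply.
apply: (measurable_funS _ Jab); first exact: measurable_itv.
apply: subspace_continuous_measurable_fun; first exact: measurable_itv.
by apply: continuous_in_subspaceT => x /set_mem; exact: (C1_oo_continuous fg).
Qed.

(** On such a segment [f] is injective, hence its image is the segment between
    the values at the ends, and [|g|] is [g] up to a constant sign, so that the
    fundamental theorem of calculus computes the right-hand side. *)
Lemma area_nonvanishing x y : a < x -> y < b -> x <= y ->
  (forall t, t \in `[x, y] -> g t != 0) ->
  mu (f @` `[x, y]) = (\int[mu]_(t in `[x, y]) `|g t|%:E)%E.
Proof.
move=> ax yb; rewrite le_eqVlt => /orP[/eqP <- _|xy g0].
  by rewrite set_itv1 image_set1 integral_set1 [LHS]lebesgue_measure_set1.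
have fi := nonvanishing_inj fg ax yb g0.
rewrite continuous_inj_image_segment ?ltW//; last exact: (C1_oo_within fg).
have gsgn : exists s : R, [/\ `|s| = 1 & forall t, t \in `[x, y] -> `|g t| = s * g t].
  have [gp|gn] := nonvanishing_sign fg ax yb g0.
    by exists 1; split=> [|t txy]; rewrite ?normr1// mul1r gtr0_norm// gp.
  by exists (-1); split=> [|t txy]; rewrite ?normrN1// mulN1r ltr0_norm// gn.
have [s [s1 gs]] := gsgn.
have FT : (\int[mu]_(t in `[x, y]) (s * g t)%:E = (s * f y)%:E - (s * f x)%:E)%E.
  have dF t : t \in `]a, b[ -> is_derive t (1 : R) (fun u => s * f u) (s * g t).
    move=> /(proj1 fg) ?; rewrite -[s * g t]/(s *: g t).
    exact: is_deriveZ.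
  have cF t : t \in `]a, b[ -> {for t, continuous (fun u => s * f u)}.
    move=> tab; apply: continuousM; first exact: cst_continuous.
    exact: (C1_oo_continuous fg).
  apply: (@continuous_FTC2 _ (fun t => s * g t) (fun t => s * f t) _ _ xy).
  - apply: continuous_in_subspaceT => t /set_mem/= txy.
    apply: continuousM; first exact: cst_continuous.
    by apply: (proj2 fg); move: txy; rewrite !in_itv/= => ?; lra.
  - split.
    + move=> t txy; have [] // := dF t; move: txy; rewrite !in_itv/= => ?; lra.
    + by apply: cvg_at_right_filter; apply: cF; rewrite in_itv/=; lra.
    + by apply: cvg_at_left_filter; apply: cF; rewrite in_itv/=; lra.
  - move=> t txy; rewrite derive1E; have [] // := dF t.
    by move: txy; rewrite !in_itv/= => ?; lra.
have -> : (\int[mu]_(t in `[x, y]) `|g t|%:E = \int[mu]_(t in `[x, y]) (s * g t)%:E)%E.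
  by apply: eq_integral => t /set_mem/= txy; rewrite gs.
rewrite FT -EFinB -mulrBr.
have -> : s * (f y - f x) = `|f y - f x|.
  have [||t txy ->] := C1_oo_MVT fg _ _ (ltW xy) => //.
  by rewrite normrM (gtr0_norm (_ : 0 < y - x)) ?subr_gt0// gs// mulrA.
rewrite lebesgue_measure_itv/= lte_fin.
have [fxy|fxy] := leP (f x) (f y).
  rewrite ger0_norm ?subr_ge0//; case: ltP => // fyx.
  by have -> : f y = f x; [lra|rewrite subrr].
by rewrite fxy ltr0_norm ?subr_lt0// opprB.
Qed.

End pieces.

(** By monotonicity the preimage of a segment is a segment, to which the
    fundamental theorem of calculus applies again. *)
Lemma preim_segment_increasing a b f g x y p q : C1_oo a b f g ->
  a < x -> y < b -> (forall t, t \in `[x, y] -> 0 < g t) ->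
  `[x, y] `&` f @^-1` `[p, q] = set0 \/
  exists x' y', [/\ x <= x', x' <= y', y' <= y &
    `[x, y] `&` f @^-1` `[p, q] = `[x', y']%classic].
Proof.
move=> fg ax yb g0.
have [->|/set0P [s0 [/= + /[!in_itv]/= /andP[ps0 s0q]]]] :=
  eqVneq (`[x, y] `&` f @^-1` `[p, q]) set0; first by left.
rewrite in_itv/= => /andP[xs0 s0y]; right.
have mono s t := @C1_oo_increasing _ _ _ _ _ _ s t fg ax yb g0.
have [x' [xx' x's0 px' Hx']] : exists x', [/\ x <= x', x' <= s0, p <= f x' &
    forall t, x <= t -> t < x' -> f t < p].
  have [pfx|fxp] := leP p (f x); first by exists x; split => // t; lra.
  have [|||x' /[!in_itv]/= /andP[xx' x's0] fx'] := @IVT R f x s0 p.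
  - by [].
  - by apply: (C1_oo_within fg); lra.
  - by rewrite ge_min le_max (ltW fxp) ps0 orbT.
  exists x'; split=> //; first by rewrite fx'.
  by move=> t xt tx'; rewrite -fx'; apply: mono => //; lra.
have [y' [y'y s0y' y'q Hy']] : exists y', [/\ y' <= y, s0 <= y', f y' <= q &
    forall t, y' < t -> t <= y -> q < f t].
  have [fyq|qfy] := leP (f y) q; first by exists y; split => // t; lra.
  have [|||y' /[!in_itv]/= /andP[s0y' y'y] fy'] := @IVT R f s0 y q.
  - by [].
  - by apply: (C1_oo_within fg); lra.
  - by rewrite ge_min le_max (ltW qfy) s0q orbT.
  exists y'; split=> //; first by rewrite fy'.
  by move=> t y't ty; rewrite -fy'; apply: mono => //; lra.
exists x', y'; split=> //; first by lra.
apply/seteqP; split=> [t [/= /[!in_itv]/= /andP[xt ty] /andP[pt tq]]|t /= /[!in_itv]/= /andP[x't ty']].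
  apply/andP; split; rewrite leNgt; apply/negP.
    by move=> /(Hx' _ xt); lra.
  by move=> /Hy' /(_ ty); lra.
split; apply/andP; split; try lra.
- move: x't; rewrite le_eqVlt => /orP[/eqP <- //|x't].
  by apply/ltW/(le_lt_trans px')/mono => //; lra.
- move: ty'; rewrite le_eqVlt => /orP[/eqP -> //|ty'].
  by apply/ltW/(lt_le_trans _ y'q)/mono => //; lra.
Qed.

Lemma area_piece a b f g x y p q : C1_oo a b f g -> a < x -> y < b ->
  (forall t, t \in `[x, y] -> g t != 0) ->
  mu (f @` `[x, y] `&` `[p, q]) =
  (\int[mu]_(t in `[x, y] `&` f @^-1` `[p, q]) `|g t|%:E)%E.
Proof.
move=> fg ax yb g0.
have -> : f @` `[x, y] `&` `[p, q] = f @` (`[x, y] `&` f @^-1` `[p, q]).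
  apply/seteqP; split => [_ [[t txy <-] fpq]|_ [t [txy fpq] <-]]; first by exists t.
  by split => //; exists t.
suff [->|[x' [y' [xx' x'y' y'y ->]]]] : `[x, y] `&` f @^-1` `[p, q] = set0 \/
  exists x' y', [/\ x <= x', x' <= y', y' <= y &
    `[x, y] `&` f @^-1` `[p, q] = `[x', y']%classic].
- by rewrite image_set0 measure0 integral_set0.
- apply: (area_nonvanishing fg) => //; try lra.
  by move=> t; rewrite in_itv/= => ?; apply: g0; rewrite in_itv/=; lra.
have [gp|gn] := nonvanishing_sign fg ax yb g0; first exact: (preim_segment_increasing p q fg).
have -> : `[x, y] `&` f @^-1` `[p, q] =
    `[x, y] `&` (fun t => - f t) @^-1` `[(- q), (- p)].
  by apply/seteqP; split => t /= [? /[!in_itv]/= ?]; split => //; rewrite ?in_itv/=; lra.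
apply: (preim_segment_increasing _ _ (C1_oo_opp fg)) => // t /gn.
by rewrite oppr_gt0.
Qed.

End area.

(** * The area formula for crossings *)

Lemma limn_einf_le_near (R : realType) (u : nat -> \bar R) (M : \bar R) :
  (\forall n \near \oo, u n <= M) -> limn_einf u <= M.
Proof.
case=> m _ um; rewrite limn_einf_lim (cvg_lim _ (@cvg_einfs_sup _ u))//.
apply: ge_ereal_sup => _ [k _ <-]; apply: le_trans (um (maxn k m) (leq_maxr _ _)).
by apply: ereal_inf_lbound; exists (maxn k m) => //=; exact: leq_maxl.
Qed.

Section area_formula.
Context {R : realType}.
Local Open Scope ring_scope.
Implicit Types (a b c d x y v p q : R) (f g : R -> R).
Local Notation mu := (@lebesgue_measure R).

Lemma sub_co_oo a b x y : a < x -> y < b -> `[x, y[ `<=` `]a, b[.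
Proof. by move=> ax yb t; rewrite /= !in_itv/= => ?; lra. Qed.

Lemma sub_cc_oo a b x y : a < x -> y < b -> `[x, y] `<=` `]a, b[.
Proof. by move=> ax yb t; rewrite /= !in_itv/= => ?; lra. Qed.

Lemma measurable_image_itv a b f g (J : set R) : C1_oo a b f g ->
  J `<=` `]a, b[ -> is_interval J -> measurable (f @` J).
Proof. by move=> fg Jab iJ; apply: is_interval_measurable; exact: (C1_oo_image_itv fg). Qed.

Lemma measure_image_co a b f g x y p q : C1_oo a b f g -> a < x -> y < b -> x <= y ->
  mu (f @` `[x, y[ `&` `[p, q]) = mu (f @` `[x, y] `&` `[p, q]).
Proof.
move=> fg ax yb xy.
have m1 : measurable (f @` `[x, y[ `&` `[p, q]).
  apply: measurableI; last exact: measurable_itv.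
  by apply: (measurable_image_itv fg); [exact: sub_co_oo|exact: interval_is_interval].
have m2 : measurable (f @` `[x, y] `&` `[p, q]).
  apply: measurableI; last exact: measurable_itv.
  by apply: (measurable_image_itv fg); [exact: sub_cc_oo|exact: interval_is_interval].
apply/eqP; rewrite eq_le; apply/andP; split.
  apply: le_measure; rewrite ?inE//; apply: setSI => _ [t txy <-]; exists t => //.
  by move: txy; rewrite /= !in_itv/= => ?; lra.
apply: (@le_trans _ _ (mu (f @` `[x, y[ `&` `[p, q] `|` [set f y]))).
  apply: le_measure; rewrite ?inE//; first exact: measurableU.
  move=> _ [[t /= + <-] fpq]; rewrite in_itv/= => /andP[xt].
  rewrite le_eqVlt => /orP[/eqP->|ty]; [by right|left; split=> //; exists t => //=].
  by rewrite in_itv/= xt.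
apply: le_trans (measureU2 _ _ _) _ => //.
by rewrite [X in (_ + X)%E]lebesgue_measure_set1 adde0.
Qed.

Lemma integral_preim_co a b f g x y p q : C1_oo a b f g -> a < x -> y < b -> x <= y ->
  (\int[mu]_(t in `[x, y[ `&` f @^-1` `[p, q]) `|g t|%:E =
   \int[mu]_(t in `[x, y] `&` f @^-1` `[p, q]) `|g t|%:E)%E.
Proof.
move=> fg ax yb xy.
have m1 := measurable_preim fg (sub_co_oo ax yb) (measurable_itv _) (measurable_itv `[p, q]).
have yab : [set y] `<=` `]a, b[ by move=> _ ->; rewrite /= in_itv/=; lra.
have m2 := measurable_preim fg yab (measurable_set1 y) (measurable_itv `[p, q]).
have cE : `[x, y] `&` f @^-1` `[p, q] =
    (`[x, y[ `&` f @^-1` `[p, q]) `|` ([set y] `&` f @^-1` `[p, q]).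
  by rewrite -setIUl; congr (_ `&` _); rewrite setUitv1//= bnd_simp.
rewrite cE ge0_integral_setU//; last 2 first.
- rewrite -cE; apply: (measurable_absd fg) => [t [+ _]|]; first exact: sub_cc_oo.
  by rewrite cE; exact: measurableU.
- rewrite disj_set2E setIACA; apply/eqP; rewrite -subset0 => t [[/= + ty] _].
  by rewrite ty in_itv/= ltxx andbF.
rewrite [X in (_ + X)%E](_ : _ = 0%E) ?adde0//.
have [fy|fy] := pselect ((f @^-1` `[p, q]) y).
  rewrite (_ : _ `&` _ = [set y]) ?integral_set1//.
  by apply/seteqP; split=> [t []//|t ->].
rewrite (_ : _ `&` _ = set0) ?integral_set0//.
by apply/seteqP; split=> // t [->].
Qed.

(** Either [g] vanishes nowhere on the cell, and both sides are equal, or it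
    vanishes somewhere, hence is at most [eta] on the cell, and both sides are at
    most [2 * eta * (y - x)]. *)
Lemma area_cell a b f g x y p q (eta : R) : C1_oo a b f g ->
  a < x -> y < b -> x <= y -> 0 <= eta ->
  (forall s t, s \in `[x, y] -> t \in `[x, y] -> `|g s - g t| <= eta) ->
  let L := mu (f @` `[x, y[ `&` `[p, q]) in
  let G := (\int[mu]_(t in `[x, y[ `&` f @^-1` `[p, q]) `|g t|%:E)%E in
  (L <= G + (2 * eta * (y - x))%:E)%E /\ (G <= L + (2 * eta * (y - x))%:E)%E.
Proof.
move=> fg ax yb xy eta0 osc.
rewrite (measure_image_co p q fg)// (integral_preim_co p q fg)//=.
have c0 : 0 <= 2 * eta * (y - x) by rewrite !mulr_ge0// subr_ge0.
have [[z zxy gz]|nz] := pselect (exists2 z, z \in `[x, y] & g z = 0); last first.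
  rewrite (area_piece p q fg)//; last first.
    by move=> t txy; apply/eqP => gt; apply: nz; exists t.
  by split; rewrite leeDl// lee_fin.
have gle t : t \in `[x, y] -> `|g t| <= eta.
  by move=> txy; have := osc t z txy zxy; rewrite gz subr0.
have mS := measurable_preim fg (sub_cc_oo ax yb) (measurable_itv _) (measurable_itv `[p, q]).
split.
  apply: (@le_trans _ _ (2 * eta * (y - x))%:E); last first.
    by rewrite leeDr// integral_ge0// => t _; rewrite lee_fin.
  apply: (@le_trans _ _ (mu `[f x - eta * (y - x), f x + eta * (y - x)])).
    apply: le_measure; rewrite ?inE//.
      apply: measurableI; last exact: measurable_itv.
      apply: (measurable_image_itv fg); [exact: sub_cc_oo|exact: interval_is_interval].
    move=> _ [[t /= txy <-] _]; rewrite /= in_itv/= -ler_distlC distrC.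
    move: (txy); rewrite in_itv/= => /andP[xt ty].
    have [||u uin ->] := C1_oo_MVT fg _ _ xt; try lra.
    rewrite normrM ler_pM// ?gle//; last by rewrite ger0_norm ?subr_ge0// lerD2r.
    by move: uin; rewrite !in_itv/= => ?; lra.
  rewrite lebesgue_measure_itv/=; case: ifPn => _; last by rewrite lee_fin.
  by rewrite -EFinB lee_fin; lra.
apply: (@le_trans _ _ (2 * eta * (y - x))%:E); last by rewrite leeDr.
apply: (@le_trans _ _ (\int[mu]_(t in `[x, y]) (cst eta%:E t))%E).
  apply: (@le_trans _ _ (\int[mu]_(t in `[x, y] `&` f @^-1` `[p, q]) (cst eta%:E t))%E).
    apply: ge0_le_integral => //.
    - by apply: (measurable_absd fg) => // t [+ _]; exact: sub_cc_oo.
    - by move=> t [+ _]; rewrite /= lee_fin; exact: gle.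
  by apply: ge0_subset_integral.
rewrite integral_cst; last exact: measurable_itv.
have /= E := lebesgue_measure_itv `[x, y]; rewrite [X in (_ * X)%E]E.
rewrite lte_fin; case: ifPn => _; last by rewrite mule0 lee_fin.
by rewrite -EFinB -EFinM lee_fin ler_wpM2r ?subr_ge0//; lra.
Qed.

Lemma hits_crossings f c d n v :
  hits c d n [set t | `[c, d[%classic t /\ f t = v] =
  (\sum_(k < n.+1) (\1_(f @` (cell c d n k `&` `[c, d[)) v)%:E)%E.
Proof.
apply: eq_bigr => k _; rewrite indicE; congr ((_ : bool)%:R%:E).
apply/idP/idP => [/asboolP[t [[tcd <-] tk]]|/set_mem[t [tk tcd] <-]].
  by rewrite inE; exists t.
by apply/asboolP; exists t.
Qed.

Lemma cell_sub c d n (k : 'I_n.+1) : c <= d -> cell c d n k `<=` `[c, d[.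
Proof.
move=> cd t; rewrite /cell/= !in_itv/= => /andP[h1 h2].
have := gridpt_itv cd (ltnW (ltn_ord k)); have := gridpt_itv cd (ltn_ord k).
by move: h1 h2; lra.
Qed.

Lemma bigcup_cell c d n : c <= d ->
  \big[setU/set0]_(k < n.+1) cell c d n k = `[c, d[%classic.
Proof.
move=> cd; apply/seteqP; split => [t|t].
  by rewrite -bigcup_seq => -[k _]; exact: cell_sub.
rewrite /= in_itv/= => /(mem_cell n)[k tk].
by rewrite -bigcup_seq; exists k => //=; rewrite mem_index_enum.
Qed.

Section grid_estimate.
Variables (a b : R) (f g : R -> R) (c d p q : R).
Hypotheses (fg : C1_oo a b f g) (ac : a < c) (clt : c < d) (db : d < b).

Let cd : c <= d. Proof. exact: ltW. Qed.

Lemma integral_hits n :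
  (\int[mu]_(v in `[p, q]) hits c d n [set t | `[c, d[%classic t /\ f t = v] =
   \sum_(k < n.+1) mu (f @` cell c d n k `&` `[p, q]))%E.
Proof.
have cE (k : 'I_n.+1) : cell c d n k `&` `[c, d[ = cell c d n k.
  by apply/setIidl; exact: cell_sub.
have mf (k : 'I_n.+1) : measurable (f @` cell c d n k).
  apply: (measurable_image_itv fg); last exact: interval_is_interval.
  by move=> t /(cell_sub cd); exact: sub_co_oo.
under eq_integral do rewrite hits_crossings.
rewrite ge0_integral_sum//=; last first.
  move=> k; apply/measurable_EFinP; apply: measurable_funTS.
  by apply: measurable_indic; rewrite cE; exact: mf.
by apply: eq_bigr => k _; rewrite cE integral_indic//; exact: mf.
Qed.

Lemma integral_cells n :
  (\int[mu]_(t in `[c, d[ `&` f @^-1` `[p, q]) `|g t|%:E =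
   \sum_(k < n.+1) \int[mu]_(t in cell c d n k `&` f @^-1` `[p, q]) `|g t|%:E)%E.
Proof.
have kab (k : 'I_n.+1) : cell c d n k `<=` `]a, b[.
  by move=> t /(cell_sub cd); exact: sub_co_oo.
have cE : `[c, d[ `&` f @^-1` `[p, q] =
    \big[setU/set0]_(k < n.+1) (cell c d n k `&` f @^-1` `[p, q]).
  by rewrite -(bigcup_cell n cd) -big_distrl.
rewrite cE ge0_integral_bigsetU//.
- move=> k; apply: (measurable_preim fg) => //; exact: measurable_itv.
- exact: index_enum_uniq.
- move=> i j _ _ [t [[ti _] [tj _]]]; apply/val_inj.
  exact: (cell_disj cd ti tj).
- rewrite -cE; apply: (measurable_absd fg) => [t [+ _]|]; first exact: sub_co_oo.
  by apply: (measurable_preim fg) => //; [exact: sub_co_oo|exact: measurable_itv..].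
Qed.

(** Sum of the estimates of [area_cell]; the errors add up to a multiple of the
    oscillation of the derivative at the scale of the mesh. The factor 2 makes room
    for the end points of a closed cell, whose distance is the mesh itself. *)
Lemma area_grid n (eta : R) : 0 <= eta ->
  (forall s t, s \in `[c, d] -> `|s - t| < 2 * ((d - c) / n.+1%:R) -> `|g s - g t| <= eta) ->
  let L := (\int[mu]_(v in `[p, q]) hits c d n [set t | `[c, d[%classic t /\ f t = v])%E in
  let G := (\int[mu]_(t in `[c, d[ `&` f @^-1` `[p, q]) `|g t|%:E)%E in
  (L <= G + (2 * eta * (d - c))%:E)%E /\ (G <= L + (2 * eta * (d - c))%:E)%E.
Proof.
move=> eta0 osc /=; rewrite integral_hits (integral_cells n).
have sE : (2 * eta * (d - c))%:E = (\sum_(k < n.+1) (2 * eta * ((d - c) / n.+1%:R))%:E)%E.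
  rewrite sumEFin sumr_const card_ord -mulrnAr -[(_ / _) *+ _]mulr_natr.
  by rewrite divfK.
have H (k : 'I_n.+1) := @area_cell a b f g (gridpt c d n k) (gridpt c d n k.+1) p q eta fg.
have {}H (k : 'I_n.+1) : (mu (f @` cell c d n k `&` `[p, q]) <=
     \int[mu]_(t in cell c d n k `&` f @^-1` `[p, q]) `|g t|%:E +
      (2 * eta * ((d - c) / n.+1%:R))%:E)%E /\
    (\int[mu]_(t in cell c d n k `&` f @^-1` `[p, q]) `|g t|%:E <=
      mu (f @` cell c d n k `&` `[p, q]) + (2 * eta * ((d - c) / n.+1%:R))%:E)%E.
  have /andP[h1 h2] := gridpt_itv cd (ltnW (ltn_ord k)).
  have /andP[h3 h4] := gridpt_itv cd (ltn_ord k).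
  have -> : (d - c) / n.+1%:R = gridpt c d n k.+1 - gridpt c d n k.
    by rewrite gridptS addrAC subrr add0r.
  apply: H => //.
  - exact: lt_le_trans ac h1.
  - exact: le_lt_trans h4 db.
  - exact: le_gridpt.
  - have m0 : 0 < (d - c) / n.+1%:R by rewrite divr_gt0// subr_gt0.
    move=> s t; rewrite gridptS in h3 h4 *; move: m0 h1 h2 h3 h4 osc.
    move: (gridpt _ _ _ _) (_ / _) => x h m0 h1 h2 h3 h4 osc.
    rewrite !in_itv/= => hs ht; apply: osc; first by rewrite in_itv/=; lra.
    by rewrite ltr_norml; lra.
by split; rewrite sE -big_split; apply: lee_sum => k _; case: (H k).
Qed.

Lemma measurable_hits_co n : measurable_fun setT
  (fun v => hits c d n [set t | `[c, d[%classic t /\ f t = v]).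
Proof.
under eq_fun do rewrite hits_crossings.
apply: emeasurable_sum => k; apply/measurable_EFinP/measurable_indic.
rewrite (_ : _ `&` _ = cell c d n k); last by apply/setIidl; exact: cell_sub.
apply: (measurable_image_itv fg); last exact: interval_is_interval.
by move=> t /(cell_sub cd); exact: sub_co_oo.
Qed.

Lemma cvg_hits_crossings v :
  hits c d n [set t | `[c, d[%classic t /\ f t = v] @[n --> \oo] -->
  crossings `[c, d[ f v.
Proof. by apply: hits_cvg => // t []. Qed.

Lemma measurable_crossings_co : measurable_fun setT (crossings `[c, d[ f).
Proof.
apply: emeasurable_fun_cvg => [n|v _]; first exact: measurable_hits_co.
exact: cvg_hits_crossings.
Qed.

Lemma oscillation_mesh (e : R) : 0 < e ->
  exists2 eta : R, 0 <= eta & (2 * eta * (d - c) <= e) /\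
    \forall n \near \oo, forall s t, s \in `[c, d] ->
      `|s - t| < 2 * ((d - c) / n.+1%:R) -> `|g s - g t| <= eta.
Proof.
move=> e0; have dc1 : 0 < d - c + 1 by rewrite addr_gt0// subr_gt0.
have eta0 : 0 < e / (2 * (d - c + 1)) by rewrite divr_gt0// mulr_gt0.
exists (e / (2 * (d - c + 1))); first exact: ltW.
split.
  have -> : 2 * (e / (2 * (d - c + 1))) * (d - c) = e * ((d - c) / (d - c + 1)).
    by field; rewrite gt_eqF.
  by rewrite -[leRHS]mulr1 ler_pM2l// ler_pdivrMr// mul1r lerDl.
have := C1_oo_unif fg ac db eta0; rewrite near_withinE => /nbhs_ballP [r /= r0 B].
have r4 : 0 < r / 4 by rewrite divr_gt0.
apply: filterS (near_lt_mesh (d - c) r4) => n hn s t scd st.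
apply: (B (r / 2)) => //; last first.
- apply: lt_trans st _; rewrite -ltr_pdivlMl// (lt_le_trans hn)//.
  by rewrite [leRHS]mulrC -mulrA ler_pM2l// -invfM -natrM.
- by rewrite divr_gt0.
- by rewrite /ball/= sub0r normrN gtr0_norm ?divr_gt0// ltr_pdivrMr// ltr_pMr// ltr1n.
Qed.

(** Cell counts never exceed the number of crossings, which gives one inequality
    in the limit of a fine mesh; they converge to it, so that Fatou's lemma gives
    the other. *)
Lemma area_co :
  (\int[mu]_(t in `[c, d[ `&` f @^-1` `[p, q]) `|g t|%:E =
   \int[mu]_(v in `[p, q]) crossings `[c, d[ f v)%E.
Proof.
have mh n : measurable_fun (`[p, q]%classic : set R)
    (fun v => hits c d n [set t | `[c, d[%classic t /\ f t = v]).
  by apply: measurable_funTS; exact: measurable_hits_co.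
apply/eqP; rewrite eq_le; apply/andP; split.
  apply/lee_addgt0Pr => e e0; have [eta eta0 [etae [m _ nm]]] := oscillation_mesh e0.
  have [_ h] := area_grid eta0 (nm m (leqnn m)); apply: (le_trans h).
  apply: leeD; last by rewrite lee_fin.
  apply: ge0_le_integral => //.
  - by move=> v _; exact: hits_ge0.
  - exact: mh.
  - by apply: measurable_funTS; exact: measurable_crossings_co.
  - by move=> v _; exact: hits_le_counting.
apply/lee_addgt0Pr => e e0; have [eta eta0 [etae [m _ nm]]] := oscillation_mesh e0.
apply: (@le_trans _ _ (limn_einf (fun n =>
   \int[mu]_(v in `[p, q]) hits c d n [set t | `[c, d[%classic t /\ f t = v])%E)).
  rewrite [leLHS](_ : _ = (\int[mu]_(v in `[p, q]) limn_einf (fun n =>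
       hits c d n [set t | `[c, d[%classic t /\ f t = v]))%E).
    by apply: fatou => // n v _; exact: hits_ge0.
  apply: eq_integral => v _.
  by have /cvg_limn_einf_sup [] := @cvg_hits_crossings v.
apply: limn_einf_le_near; exists m => // n mn.
have [h _] := area_grid eta0 (nm n mn); apply: (le_trans h).
by apply: leeD => //; rewrite lee_fin.
Qed.

End grid_estimate.
(** The sequences [lo] and [hi] exhaust the open interval; the shift by 3 makes
    [lo a b n < hi a b n] true from [n = 0] on. *)
Definition lo a b n : R := a + (b - a) / n.+3%:R.
Definition hi a b n : R := b - (b - a) / n.+3%:R.

Lemma lo_hi a b n : a < b -> [/\ a < lo a b n, lo a b n < hi a b n & hi a b n < b].
Proof.
move=> ab; rewrite /lo /hi.
have h0 : 0 < (b - a) / n.+3%:R by rewrite divr_gt0// subr_gt0.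
have h1 : (b - a) / n.+3%:R <= (b - a) / 3%:R.
  by rewrite ler_pM2l ?subr_gt0// lef_pV2 ?posrE// ler_nat.
by move: (_ / n.+3%:R) h0 h1 => h h0 h1; split; lra.
Qed.

Lemma le_lo_hi a b n m : a < b -> (n <= m)%N -> lo a b m <= lo a b n /\ hi a b n <= hi a b m.
Proof.
move=> ab nm; rewrite lerD2l lerD2l lerN2.
by split; rewrite ler_pM2l ?subr_gt0// lef_pV2 ?posrE// ler_nat !ltnS.
Qed.

Lemma near_lo_hi a b t : a < b -> t \in `]a, b[ ->
  \forall n \near \oo, lo a b n <= t < hi a b n.
Proof.
move=> ab; rewrite in_itv/= => /andP[at' tb].
have r0 : 0 < Num.min (t - a) (b - t) by rewrite lt_min !subr_gt0 at'.
apply: filterS (near_lt_mesh (b - a) r0) => n; rewrite lt_min => /andP[h1 h2].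
have h3 : (b - a) / n.+3%:R <= (b - a) / n.+1%:R.
  by rewrite ler_pM2l ?subr_gt0// lef_pV2 ?posrE// ler_nat; exact: (leqW (leqnSn n)).
by rewrite /lo /hi; move: (_ / n.+3%:R) (_ / n.+1%:R) h1 h2 h3 => h h' h1 h2 h3; lra.
Qed.

Lemma bigcup_lo_hi a b : a < b -> \bigcup_n `[lo a b n, hi a b n[%classic = `]a, b[%classic.
Proof.
move=> ab; apply/seteqP; split=> [t [n _]|t tab].
  by have [h1 _ h2] := lo_hi n ab; exact: sub_co_oo.
have [n _ /(_ n (leqnn n)) nt] := near_lo_hi ab tab.
by exists n => //=; rewrite in_itv.
Qed.

Section area_open.
Variables (a b : R) (f g : R -> R).
Hypotheses (ab : a < b).

Lemma cvg_crossings_lo_hi v :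
  crossings `[lo a b n, hi a b n[ f v @[n --> \oo] --> (crossings `]a, b[ f v : \bar R).
Proof.
apply: counting_cvg => [n|s us sA].
  apply: counting_le_size => s us sA; apply: le_size_counting => // t /sA[tn ft].
  by split=> //; have [h1 _ h2] := lo_hi n ab; exact: sub_co_oo tn.
have : \forall n \near \oo, forall t, t \in s -> lo a b n <= t < hi a b n.
  by apply: near_all_seq => t /sA[tab _]; exact: near_lo_hi.
apply: filterS => n ns; apply: le_size_counting => // t ts.
by have [_ ft] := sA t ts; split=> //=; rewrite in_itv/=; exact: ns.
Qed.

Hypothesis fg : C1_oo a b f g.

Lemma area_formula p q :
  (\int[mu]_(t in `]a, b[ `&` f @^-1` `[p, q]) `|g t|%:E =
   \int[mu]_(v in `[p, q]) crossings `]a, b[ f v)%E.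
Proof.
pose S n := `[lo a b n, hi a b n[%classic `&` f @^-1` `[p, q].
have Sab n : `[lo a b n, hi a b n[ `<=` `]a, b[.
  by have [h1 _ h2] := lo_hi n ab; exact: sub_co_oo.
have mS n : measurable (S n).
  by apply: (measurable_preim fg) => //; exact: measurable_itv.
have L : (\int[mu]_(t in S n) `|g t|%:E)%E @[n --> \oo] -->
    (\int[mu]_(t in `]a, b[ `&` f @^-1` `[p, q]) `|g t|%:E)%E.
  have -> : `]a, b[ `&` f @^-1` `[p, q] = \bigcup_n S n.
    by rewrite -(bigcup_lo_hi ab) setI_bigcupl.
  apply: ge0_nondecreasing_set_cvg_integral => //.
  - move=> n m nm; apply/subsetPset => t [/= tn ftn]; split => //; move: tn.
    have [h1 h2] := le_lo_hi ab nm; rewrite /= !in_itv/= => /andP[h3 h4].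
    by rewrite (le_trans h1 h3) (lt_le_trans h4 h2).
  - by move=> n; apply: (measurable_absd fg) => // t [/Sab].
have Rr : (\int[mu]_(v in `[p, q]) crossings `[lo a b n, hi a b n[ f v)%E @[n --> \oo] -->
    (\int[mu]_(v in `[p, q]) crossings `]a, b[ f v)%E.
  have -> : (\int[mu]_(v in `[p, q]) crossings `]a, b[ f v =
     \int[mu]_(v in `[p, q]) limn (fun n => crossings `[lo a b n, hi a b n[ f v))%E.
    apply: eq_integral => v _; apply/esym/cvg_lim => //; exact: cvg_crossings_lo_hi.
  apply: cvg_monotone_convergence => //.
  - move=> n; apply: measurable_funTS; have [h1 h2 h3] := lo_hi n ab.
    exact: (measurable_crossings_co fg).
  - move=> v _ n m nm; apply: counting_le_size => s us sA; apply: le_size_counting => // t /sA.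
    move=> [+ ft]; have [h1 h2] := le_lo_hi ab nm; rewrite /= !in_itv/= => /andP[h3 h4].
    by split=> //; rewrite (le_trans h1 h3) (lt_le_trans h4 h2).
have E n : (\int[mu]_(t in S n) `|g t|%:E =
    \int[mu]_(v in `[p, q]) crossings `[lo a b n, hi a b n[ f v)%E.
  by have [h1 h2 h3] := lo_hi n ab; rewrite /S (area_co _ _ fg).
rewrite -(cvg_lim _ Rr)//; apply/esym/cvg_lim => //.
by rewrite -(funext E); exact: L.
Qed.

End area_open.
End area_formula.

(** * Stability of the number of crossings in the level *)

Section locally_constant.
Context {R : realType}.
Local Open Scope ring_scope.
Implicit Types (a b c d x y v u : R) (f g : R -> R).

(** At a point where the derivative does not vanish, [f] takes values on both
    sides of [f t], so that nearby levels are attained. *)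
Lemma straddle a b f g t r : C1_oo a b f g -> 0 < r -> a < t - r -> t + r < b ->
  (forall x, x \in `[t - r, t + r] -> g x != 0) ->
  \forall v \near f t, exists2 x, `|t - x| < r & f x = v.
Proof.
move=> fg r0 atr trb g0.
have : \forall v \near f t, Num.min (f (t - r)) (f (t + r)) < v < Num.max (f (t - r)) (f (t + r)).
  suff : Num.min (f (t - r)) (f (t + r)) < f t < Num.max (f (t - r)) (f (t + r)).
    move=> ft; have ft' : f t \in `]Num.min (f (t - r)) (f (t + r)), Num.max (f (t - r)) (f (t + r))[.
      by rewrite in_itv.
    by apply: filterS (near_in_itvoo ft') => v; rewrite in_itv.
  have [gp|gn] := nonvanishing_sign fg atr trb g0.
    have h1 : f (t - r) < f t by apply: (C1_oo_increasing fg atr trb gp); lra.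
    have h2 : f t < f (t + r) by apply: (C1_oo_increasing fg atr trb gp); lra.
    by rewrite gt_min lt_max h1 h2 orbT.
  have gn' x : x \in `[t - r, t + r] -> 0 < - g x by move=> /gn; rewrite oppr_gt0.
  have h1 : - f (t - r) < - f t by apply: (C1_oo_increasing (C1_oo_opp fg) atr trb gn'); lra.
  have h2 : - f t < - f (t + r) by apply: (C1_oo_increasing (C1_oo_opp fg) atr trb gn'); lra.
  by rewrite !ltrN2 in h1 h2; rewrite gt_min lt_max h1 h2 orbT.
apply: filterS => v /andP[v1 v2].
have tr : t - r <= t + r by lra.
have [|x xin fx] := IVT (v := v) tr (C1_oo_within fg atr trb); first by rewrite !ltW.
exists x => //; rewrite ltr_distl; move: xin; rewrite in_itv/= => /andP[h1 h2].
have n1 : x != t - r.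
  by apply/eqP => xE; move: v1 v2; rewrite -fx xE gt_min lt_max ltxx/=; lra.
have n2 : x != t + r.
  by apply/eqP => xE; move: v1 v2; rewrite -fx xE gt_min lt_max ltxx !orbF/=; lra.
have h1' : t - r < x by rewrite lt_neqAle eq_sym n1 h1.
have h2' : x < t + r by rewrite lt_neqAle n2 h2.
by apply/andP; split; lra.
Qed.

Lemma near_nonzero a b f g t : C1_oo a b f g -> t \in `]a, b[ -> g t != 0 ->
  \forall r \near 0^'+, [/\ a < t - r, t + r < b &
     forall x, x \in `[t - r, t + r] -> g x != 0].
Proof.
move=> fg tab gt.
have : \forall x \near t, (x \in `]a, b[) /\ g x != 0.
  apply: filterI; first by apply: open_nbhs_nbhs; split; [exact: interval_open|].
  exact: (cvgr_neq0 _ (proj2 fg t tab) gt).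
move=> /nbhs_ballP[e /= e0 B].
near=> r.
have r0 : 0 < r by near: r; exact: nbhs_right_gt.
have re : r < e by near: r; exact: nbhs_right_lt.
have H x : x \in `[t - r, t + r] -> (x \in `]a, b[) /\ g x != 0.
  rewrite in_itv/= => xr; apply: B; rewrite /ball/= ltr_distl; apply/andP; split; lra.
split => [||x /H[]//].
  by have [|] := H (t - r); rewrite in_itv/=; lra.
by have [|] := H (t + r); rewrite in_itv/=; lra.
Unshelve. all: by end_near. Qed.

(** The finitely many points at level [u] are isolated. For [v] close to [u],
    each one has exactly one point at level [v] within a small radius [r]
    (existence by [straddle], uniqueness by Rolle's theorem), and there is none
    elsewhere, because [f] keeps away from [u] near the ends and on the compact
    set left in between. *)
Lemma crossings_locally_constant a b f g u (eta : R) : C1_oo a b f g ->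
  (crossings `]a, b[ f u < +oo)%E ->
  (forall t, t \in `]a, b[ -> f t = u -> g t != 0) ->
  0 < eta ->
  (\forall t \near a^'+, eta <= `|f t - u|) ->
  (\forall t \near b^'-, eta <= `|f t - u|) ->
  \forall v \near u, crossings `]a, b[ f v = crossings `]a, b[ f u :> \bar R.
Proof.
move=> fg fin nd eta0 na nb.
pose A v := [set t | `]a, b[%classic t /\ f t = v].
have finA : finite_set (A u).
  by move: fin; rewrite /crossings /counting; case: ifPn => [/asboolP|].
have [s sE] : exists s : seq R, forall t, t \in s <-> A u t.
  by exists (fset_set (A u)) => t; rewrite in_fset_set// inE.
have [c ac Hc] : exists2 c, a < c & forall t, a < t -> t < c -> eta <= `|f t - u|.
  move: na; rewrite near_withinE => /nbhs_ballP[e /= e0 B].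
  exists (a + e) => [|t at' tc]; first by rewrite ltrDl.
  by apply: B => //; rewrite /ball/= ltr_distl; apply/andP; split; lra.
have [d db Hd] : exists2 d, d < b & forall t, d < t -> t < b -> eta <= `|f t - u|.
  move: nb; rewrite near_withinE => /nbhs_ballP[e /= e0 B].
  exists (b - e) => [|t at' tc]; first by rewrite ltrBlDr ltrDl.
  by apply: B => //; rewrite /ball/= ltr_distl; apply/andP; split; lra.
near (0 : R)^'+ => r.
have r0 : 0 < r by near: r; exact: nbhs_right_gt.
have R1 : forall t, t \in s -> [/\ a < t - r, t + r < b &
     forall x, x \in `[t - r, t + r] -> g x != 0].
  near: r; apply: near_all_seq => t /sE[tab ft].
  by apply: (near_nonzero fg) => //; exact: nd.
have R2 : forall t, t \in s -> forall t', t' \in s -> t != t' -> 2 * r <= `|t - t'|.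
  near: r; apply: near_all_seq => t ts; apply: near_all_seq => t' ts'.
  have [->|tt'] := eqVneq t t'; first exact: nearW.
  have tt0 : 0 < `|t - t'| / 2 by rewrite divr_gt0// normr_gt0 subr_eq0.
  near=> r => _.
  have : r < `|t - t'| / 2 by near: r; exact: nbhs_right_lt.
  by lra.
pose K := `[c, d]%classic `&` [set x | forall t, t \in s -> r <= `|t - x|].
have cK : compact K.
  apply: compact_closedI; first exact: segment_compact.
  have -> : [set x | forall t, t \in s -> r <= `|t - x|] =
      \bigcap_(t in [set` s]) ~` ball t r.
    apply/seteqP; split => [x h t /= /h|x h t ts]; first by rewrite /ball/= => ? /lt_geF; lra.
    by rewrite leNgt; apply/negP; exact: h.
  by apply: closed_bigI => t _; apply: open_closedC; exact: ball_open.
have cfK : closed (f @` K).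
  apply: compact_closed; first exact: Rhausdorff.
  apply: continuous_compact => //; apply: continuous_subspaceW (C1_oo_within fg ac db).
  by move=> x [].
have uK : ~ (f @` K) u.
  move=> [x [/= xcd xs] fx].
  have xs' : x \in s.
    by apply/sE; split=> //=; move: xcd; rewrite !in_itv/= => ?; lra.
  by have := xs x xs'; rewrite subrr normr0; lra.
near=> v.
have V1 : ~ (f @` K) v.
  by near: v; apply: open_nbhs_nbhs; split; [exact: closed_openC|].
have V2 : `|v - u| < eta.
  by near: v; apply/nbhs_ballP; exists eta => // y; rewrite /ball/= distrC.
have V3 : forall t, t \in s -> exists2 x, `|t - x| < r & f x = v.
  near: v; apply: near_all_seq => t ts; have [_ <-] := (sE t).1 ts.
  by have [h1 h2 h3] := R1 t ts; exact: (straddle fg).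
have in_ball t x : t \in s -> `|t - x| < r -> (x \in `]a, b[) /\ x \in `[t - r, t + r].
  move=> ts; have [h1 h2 _] := R1 t ts; rewrite ltr_distlC => /andP[h3 h4].
  by rewrite !in_itv/=; split; lra.
apply/eqP; rewrite eq_le; apply/andP; split; apply: counting_le_size => l ul lA.
  have [w wP] : exists w : R -> R, forall x, x \in l -> w x \in s /\ `|w x - x| < r.
    exists (fun x => get [set t | t \in s /\ `|t - x| < r]) => x xl.
    suff [t ht] : exists t, t \in s /\ `|t - x| < r.
      exact: (@getI _ [set t | t \in s /\ `|t - x| < r] t).
    have [xab fx] := lA x xl.
    apply: contrapT => nt; apply: V1; exists x => //; split; last first.
      by move=> t ts /=; rewrite leNgt; apply/negP => tx; apply: nt; exists t.
    move: xab; rewrite /= !in_itv/= => /andP[ax xb].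
    apply/andP; split; rewrite leNgt; apply/negP => h.
      by have := Hc x ax h; rewrite fx leNgt V2.
    by have := Hd x h xb; rewrite fx leNgt V2.
  rewrite -(size_map w); apply: le_size_counting.
    rewrite map_inj_in_uniq// => x y xl yl wxy.
    have [wx xw] := wP x xl; have [wy yw] := wP y yl.
    have [_ _ g0] := R1 _ wx; have [h1 h2 _] := R1 _ wx.
    apply: (nonvanishing_inj fg h1 h2 g0).
    - by have [] := in_ball _ _ wx xw.
    - by rewrite wxy; have [] := in_ball _ _ wy yw.
    - by have [_ ->] := lA x xl; have [_ ->] := lA y yl.
  by move=> _ /mapP [x xl ->]; apply/sE; have [] := wP x xl.
have [w wP] : exists w : R -> R, forall t, t \in s -> `|t - w t| < r /\ f (w t) = v.
  exists (fun t => get [set x | `|t - x| < r /\ f x = v]) => t ts.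
  have [x h1 h2] := V3 t ts.
  exact: (@getI _ [set x | `|t - x| < r /\ f x = v] x).
have ls t : t \in l -> t \in s by move=> /lA /sE.
rewrite -(size_map w); apply: le_size_counting.
  rewrite map_inj_in_uniq// => x y /ls xs /ls ys wxy; apply/eqP/negPn/negP => xy.
  have [h1 _] := wP x xs; have [h2 _] := wP y ys.
  have := R2 x xs y ys xy; rewrite leNgt => /negP; apply.
  apply: le_lt_trans (ler_distD (w x) _ _) _.
  by rewrite [X in _ + X]distrC {2}wxy mulr2n mulrDl mul1r ltrD.
move=> _ /mapP [t /ls ts ->]; have [h1 h2] := wP t ts; split=> //.
by have [] := in_ball _ _ ts h1.
Unshelve. all: by end_near. Qed.

End locally_constant.

(** * Joint measurability in time, level and randomness *)

(** The retraction of the line onto [[x, y]]; it is 1-Lipschitz, so the images of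
    the rationals are dense in the segment even when it is a point. *)
Definition clamp (R : realType) (x y q : R) : R := Num.max x (Num.min q y).

Lemma clamp_dist (R : realType) (x y z t r : R) : (x <= t)%R -> (t <= y)%R ->
  (t - r < z)%R -> (z < t + r)%R -> (`|t - clamp x y z| < r)%R.
Proof.
move=> xt ty z1 z2; rewrite ltr_distl /clamp.
have [?|?] := leP z y; first by have [?|?] := leP x z; apply/andP; split; lra.
by have [?|?] := leP x y; apply/andP; split; lra.
Qed.

Section process_measurability.
Context d (T : measurableType d) (R : realType).
Local Open Scope ring_scope.
Variables (X X' : R -> T -> R) (a b : R).
Hypotheses (ab : a < b) (mX : forall t, measurable_fun setT (X t)).
Hypothesis XC1 : forall w, C1_oo a b (X^~ w) (X'^~ w).

Definition step_process n (tw : R * T) : R :=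
  \sum_(k < n.+1) \1_(cell a b n k) tw.1 * X (gridpt a b n k) tw.2.

Lemma measurable_step_process n : measurable_fun setT (step_process n).
Proof.
apply: measurable_sum => k; apply: measurable_funM.
  by apply: measurableT_comp => //; apply: measurable_indic; exact: measurable_itv.
exact: measurableT_comp.
Qed.

Lemma step_process_cvg t w : t \in `]a, b[ ->
  step_process n (t, w) @[n --> \oo] --> X t w.
Proof.
move=> tab; have tab' : a <= t < b by move: tab; rewrite in_itv/= => ?; lra.
have : X s w @[s --> t] --> X t w by exact: (C1_oo_continuous (XC1 w)).
move=> /cvgrPdist_lt Xc; apply/cvgrPdist_lt => e /Xc /nbhs_ballP[r /= r0 B].
apply: filterS (near_lt_mesh (b - a) r0) => n nr.
have [k tk] := mem_cell n tab'.
have -> : step_process n (t, w) = X (gridpt a b n k) w.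
  rewrite /step_process (bigD1 k)//= big1 ?addr0; last first.
    move=> j jk; rewrite indicE memNset ?mul0r// => tj.
    by move/eqP : jk; apply; apply/val_inj/(cell_disj (ltW ab) tj tk).
  by rewrite indicE mem_set// mul1r.
apply: B; move: tk; rewrite /ball/= /cell/= in_itv/= gridptS.
move: (gridpt _ _ _ _) (_ / _) nr => x h nr /andP[h1 h2].
by rewrite ltr_distl; apply/andP; split; lra.
Qed.

(** Paths are continuous, so the process is a limit of processes that are
    constant in time on the cells of a grid. *)
Lemma measurable_process_oo :
  measurable_fun (`]a, b[ `*` setT) (fun tw : R * T => X tw.1 tw.2).
Proof.
apply: (measurable_fun_cvg (h := step_process)).
  by move=> n; apply: measurable_funTS; exact: measurable_step_process.
by move=> [t w] [/= tab _]; exact: step_process_cvg.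
Qed.

(** The increment of time is proportional to [b - t] so that the second point
    stays in the open interval. *)
Definition quot_process n (tw : R * T) : R :=
  (X (tw.1 + (b - tw.1) / n.+2%:R) tw.2 - X tw.1 tw.2) / ((b - tw.1) / n.+2%:R).

Lemma quot_process_cvg t w : t \in `]a, b[ ->
  quot_process n (t, w) @[n --> \oo] --> X' t w.
Proof.
move=> tab; have [Xd <-] := proj1 (XC1 w) t tab.
have /cvgrPdist_lt Xc : h^-1 *: (((X^~ w) \o shift t) (h *: 1) - X t w) @[h --> 0^'] --> 'D_1 (X^~ w) t by [].
apply/cvgrPdist_lt => e /Xc; rewrite near_withinE => /nbhs_ballP[r /= r0 B].
apply: filterS (near_lt_mesh (b - t) r0) => n nr.
have bt0 : 0 < b - t by rewrite subr_gt0; move: tab; rewrite in_itv/= => /andP[].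
have h0 : 0 < (b - t) / n.+2%:R by rewrite divr_gt0.
have := B ((b - t) / n.+2%:R); rewrite /quot_process/= -[_%:A]/(_ * 1) mulr1.
rewrite [_ *: _]mulrC [_ + t]addrC; apply; last by rewrite gt_eqF.
rewrite /ball/= sub0r normrN gtr0_norm//; apply: le_lt_trans nr.
by rewrite ler_pM2l// lef_pV2 ?posrE// ler_nat.
Qed.

Lemma measurable_derivative_oo :
  measurable_fun (`]a, b[ `*` setT) (fun tw : R * T => X' tw.1 tw.2).
Proof.
have mD : measurable (`]a, b[%classic `*` [set: T]) by apply: measurableX => //; exact: measurable_itv.
apply: (measurable_fun_cvg (h := quot_process)); last first.
  by move=> [t w] [/= tab _]; exact: quot_process_cvg.
move=> n; have mh : measurable_fun setT (fun tw : R * T => (b - tw.1) / n.+2%:R).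
  by apply: measurable_funM => //; apply: measurable_funB.
apply: measurable_funM.
  apply: measurable_funB; last exact: measurable_process_oo.
  apply: (@measurable_comp _ _ _ _ _ _ (`]a, b[%classic `*` [set: T])
    (fun tw : R * T => X tw.1 tw.2) _ (fun tw : R * T => (tw.1 + (b - tw.1) / n.+2%:R, tw.2))) => //.
  - move=> _ [[t w] [/= tab _] <-]; split=> //=.
    move: tab; rewrite /= !in_itv/= => /andP[h1 h2].
    have h0 : 0 < (b - t) / n.+2%:R by rewrite divr_gt0// subr_gt0.
    have h3 : (b - t) / n.+2%:R < (b - t) by rewrite ltr_pdivrMr// ltr_pMr ?subr_gt0// ltr1n.
    by move: (_ / _) h0 h3 => h h0 h3; lra.
  - exact: measurable_process_oo.
  - by apply/measurable_funTS/measurable_fun_pair => //; exact: measurable_funD.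
apply: (@measurable_comp _ _ _ _ _ _ `]a, b[%classic
  (fun t : R => ((b - t) / n.+2%:R)^-1) _ (fst : R * T -> R)) => //.
- by move=> _ [[t w] [/= tab _] <-].
- apply: subspace_continuous_measurable_fun; first exact: measurable_itv.
  apply: continuous_in_subspaceT => t /set_mem/=; rewrite in_itv/= => /andP[_ tb].
  apply: cvgV; first by rewrite mulf_neq0// gt_eqF// subr_gt0.
  by apply: cvgMl; apply: cvgB; [exact: cvg_cst|exact: cvg_id].
- exact: measurable_funTS.
Qed.

(** By compactness, a path attains [v] on the segment if and only if its values
    at the clamped rationals come arbitrarily close to [v]. This keeps tangential
    crossings, which sign changes at the rationals would miss. *)
Lemma measurable_hit_cc x y : a < x -> y < b ->
  measurable [set vw : R * T | exists2 t, t \in `[x, y] & X t vw.2 = vw.1].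
Proof.
move=> ax yb; have [xy|yx] := leP x y; last first.
  rewrite (_ : mkset _ = set0)// -subset0 => -[v w] [t /=].
  by rewrite in_itv/=; lra.
have -> : [set vw : R * T | exists2 t, t \in `[x, y] & X t vw.2 = vw.1] =
    \bigcap_m \bigcup_(q : rat) [set vw : R * T |
      `|X (clamp x y (ratr q)) vw.2 - vw.1| < m.+1%:R^-1].
  apply/seteqP; split=> [[v w] [t /= txy <-] m _|[v w] H].
    have tab : t \in `]a, b[ by move: txy; rewrite !in_itv/=; lra.
    have : X s w @[s --> t] --> X t w by exact: (C1_oo_continuous (XC1 w)).
    move=> /cvgrPdist_lt/(_ m.+1%:R^-1); rewrite invr_gt0 => /(_ (ltr0Sn _ _)).
    move=> /nbhs_ballP[r /= r0 B].
    have /rat_in_itvoo[q] : t - r < t + r by lra.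
    rewrite in_itv/= => /andP[q1 q2].
    exists q => //=; rewrite distrC; apply: B.
    by move: txy; rewrite in_itv/= => /andP[xt ty]; exact: clamp_dist.
  have : closed (X^~ w @` `[x, y]).
    apply: compact_closed; first exact: Rhausdorff.
    by apply: continuous_compact; [exact: (C1_oo_within (XC1 w))|exact: segment_compact].
  move=> cX; suff [t /= txy Xt] : (X^~ w @` `[x, y]) v by exists t.
  apply: cX; move=> A /nbhs_ballP[r /= r0 B].
  have [m _ /(_ m (leqnn m)) mr] := near_lt_mesh 1 r0.
  have [q _ /= qm] := H m I.
  exists (X (clamp x y (ratr q)) w); split.
    exists (clamp x y (ratr q)) => //=; rewrite in_itv/= /clamp.
    by rewrite le_max lexx/= ge_max xy/= ge_min lexx orbT.
  by apply: B; rewrite /ball/= distrC (lt_trans qm)// -[ltLHS]mul1r.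
apply: bigcapT_measurable => m; apply: bigcupT_measurable_rat => q.
rewrite -[X in measurable X]setTI.
have mf : measurable_fun setT (fun vw : R * T => `|X (clamp x y (ratr q)) vw.2 - vw.1|).
  apply: measurableT_comp => //; apply: measurable_funB => //.
  exact: (measurableT_comp (mX _)).
have := mf measurableT _ (measurable_itv `]-oo, (m.+1%:R^-1)[).
by congr (measurable (_ `&` _)); apply/seteqP; split=> vw; rewrite /= in_itv.
Qed.

Lemma measurable_hit_co x y : a < x -> y < b ->
  measurable [set vw : R * T | (X^~ vw.2 @` `[x, y[) vw.1].
Proof.
move=> ax yb.
have -> : [set vw : R * T | (X^~ vw.2 @` `[x, y[) vw.1] =
    \bigcup_j [set vw : R * T | exists2 t, t \in `[x, (y - j.+1%:R^-1)] & X t vw.2 = vw.1].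
  apply/seteqP; split => [[v w] [t /= + <-]|[v w] [j _ [t /= txy <-]]].
    rewrite in_itv/= => /andP[xt ty].
    have yt0 : 0 < y - t by rewrite subr_gt0.
    have [m _ /(_ m (leqnn m)) mr] := near_lt_mesh 1 yt0.
    exists m => //; exists t => //; rewrite in_itv/= xt/=.
    by rewrite lerBrDr -lerBrDl ltW// -[ltLHS]mul1r.
  exists t => //; move: txy; rewrite /= !in_itv/= => /andP[-> h]; apply: (le_lt_trans h).
  by rewrite ltrBlDr ltrDl invr_gt0.
apply: bigcupT_measurable => j; apply: measurable_hit_cc => //.
by apply: le_lt_trans yb; rewrite lerBlDr lerDl invr_ge0.
Qed.

Lemma measurable_crossings_process :
  measurable_fun setT (fun vw : R * T => crossings `]a, b[ (X^~ vw.2) vw.1).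
Proof.
apply: (emeasurable_fun_cvg (fun n (vw : R * T) =>
    crossings `[lo a b n, hi a b n[ (X^~ vw.2) vw.1)); last first.
  by move=> vw _; exact: cvg_crossings_lo_hi.
move=> n; have [h1 h2 h3] := lo_hi n ab.
apply: (emeasurable_fun_cvg (fun m (vw : R * T) => hits (lo a b n) (hi a b n) m
   [set t | `[lo a b n, hi a b n[%classic t /\ X t vw.2 = vw.1])); last first.
  by move=> vw _; exact: cvg_hits_crossings.
move=> m; under eq_fun do rewrite hits_crossings.
apply: emeasurable_sum => k; apply/measurable_EFinP.
rewrite (_ : (fun _ => _) = \1_[set vw : R * T |
   (X^~ vw.2 @` `[gridpt (lo a b n) (hi a b n) m k, gridpt (lo a b n) (hi a b n) m k.+1[) vw.1]).
  apply: measurable_indic; apply: measurable_hit_co.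
    have /andP[h4 _] := gridpt_itv (ltW h2) (ltnW (ltn_ord k)); exact: lt_le_trans h4.
  have /andP[_ h4] := gridpt_itv (ltW h2) (ltn_ord k); exact: le_lt_trans h3.
apply/funext => vw; rewrite (_ : _ `&` _ = cell (lo a b n) (hi a b n) m k); last first.
  by apply/setIidl; move=> t /(cell_sub (ltW h2)).
by rewrite !indicE; congr (_%:R); apply/idP/idP => /set_mem h; apply/mem_set.
Qed.

End process_measurability.

(** * Exceptional events and behaviour at the ends of the interval *)

Section liminf_events.
Context d (T : measurableType d) (R : realType) (P : probability T R).

Lemma probability_liminf_le (G : nat -> set T) (c : \bar R) :
  (forall n, measurable (G n)) -> (\forall n \near \oo, P (G n) <= c) ->
  P (\bigcup_m \bigcap_(n in [set n | (m <= n)%N]) G n) <= c.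
Proof.
move=> mG [N _ Nc].
pose F m := \bigcap_(n in [set n | (m <= n)%N]) G n.
have mF m : measurable (F m) by exact: bigcap_measurableType.
have cF : P (F m) @[m --> \oo] --> P (\bigcup_m F m).
  apply: nondecreasing_cvg_mu => //; first exact: bigcup_measurable.
  move=> i j ij; apply/subsetPset => w Fw n /= jn; apply: Fw => /=.
  exact: leq_trans jn.
rewrite -(cvg_lim _ cF)//; apply: lime_le; first by apply/cvg_ex; eexists; exact: cF.
exists N => // m Nm; apply: le_trans (Nc m Nm).
by apply: le_measure; rewrite ?inE// => w; apply => /=.
Qed.

(** Through [C * eta -> 0], this deals with events [A] that need not be measurable:
    outside a null set each outcome of [A] lies in all [G n] with [n] large, and
    the lower limit of the [G n] has probability at most [C * eta]. *)
Lemma negligible_liminf (A : set T) (C : R) (eps : R) : (0 < eps)%R ->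
  (forall eta : R, (0 < eta)%R -> (eta < eps)%R -> exists (N : set T) (G : nat -> set T),
    [/\ P.-negligible N, forall n, measurable (G n),
     \forall n \near \oo, P (G n) <= (C * eta)%:E &
     forall w, A w -> N w \/ \forall n \near \oo, G n w]) ->
  P.-negligible A.
Proof.
move=> eps0 H.
have H' (eta : R) : (0 < eta)%R -> (eta < eps)%R -> exists B : set T,
    [/\ measurable B, P B <= (C * eta)%:E & A `<=` B].
  move=> e0 e1; have [N [G [[N' [mN' N'0 NN']] mG PG AG]]] := H eta e0 e1.
  set L := \bigcup_m \bigcap_(n in [set n | (m <= n)%N]) G n.
  have mL : measurable L.
    by apply: bigcup_measurable => m _; exact: bigcap_measurableType.
  exists (N' `|` L); split; first exact: measurableU.
    apply: le_trans (measureU2 _ _ _) _ => //.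
    by rewrite [X in X + _]N'0 add0e; exact: probability_liminf_le.
  move=> w /AG[/NN' ?|[m _ mGw]]; first by left.
  by right; exists m => // n /= mn; exact: mGw.
pose e n : R := (eps / n.+2%:R)%R.
have e0 n : (0 < e n)%R by rewrite divr_gt0.
have e1 n : (e n < eps)%R by rewrite ltr_pdivrMr// ltr_pMr// ltr1n.
have [B BP] := choice (fun n => H' _ (e0 n) (e1 n)).
exists (\bigcap_n B n); split.
- by apply: bigcapT_measurable => n; have [] := BP n.
- apply/eqP; rewrite eq_le measure_ge0 andbT.
  apply/lee_addgt0Pr => r r0; rewrite add0e.
  have [m _ /(_ m (leqnn m)) mr] := near_lt_mesh (C * eps) r0.
  have [C0|C0] := leP C 0%R.
    have [mB PB _] := BP 0%N; apply: (@le_trans _ _ (P (B 0%N))).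
      apply: le_measure; rewrite ?inE//; last exact: bigcap_inf.
      by apply: bigcapT_measurable => n; have [] := BP n.
    apply: (le_trans PB); rewrite lee_fin (le_trans _ (ltW r0))//.
    by rewrite mulr_le0_ge0// ltW.
  have [mB PB _] := BP m; apply: (@le_trans _ _ (P (B m))).
    apply: le_measure; rewrite ?inE//; last exact: bigcap_inf.
    by apply: bigcapT_measurable => n; have [] := BP n.
  apply: (le_trans PB); rewrite lee_fin; apply: le_trans (ltW mr).
  rewrite /e mulrA ler_pM2l ?mulr_gt0// lef_pV2 ?posrE// ler_nat.
  exact: leqnSn.
- by move=> w Aw n _; have [_ _] := BP n; apply.
Qed.

End liminf_events.

Section boundary.
Context {R : realType}.
Local Open Scope ring_scope.
Implicit Types (a b u eta : R) (f g : R -> R).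

Lemma finite_crossings_near a b f v (F : set_system R) {FF : Filter F} :
  (crossings `]a, b[ f v < +oo)%E ->
  (forall x, x \in `]a, b[ -> \forall t \near F, t != x) ->
  (\forall t \near F, t \in `]a, b[) ->
  \forall t \near F, f t != v.
Proof.
move=> fin Fx Fab; pose A := [set t | `]a, b[%classic t /\ f t = v].
have finA : finite_set A.
  by move: fin; rewrite /crossings /counting; case: ifPn => [/asboolP|].
have : \forall t \near F, forall x, x \in (fset_set A : seq R) -> t != x.
  apply: near_all_seq => x; rewrite in_fset_set// => /set_mem[xab _]; exact: Fx.
apply: filterS2 Fab => t tab h; apply/eqP => ft.
have tA : t \in (fset_set A : seq R) by rewrite in_fset_set// inE.
by have := h t tA; rewrite eqxx.
Qed.

(** By the intermediate value theorem, [f - u] cannot pass from one side of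
    [eta] in absolute value to the other without reaching [eta] or [- eta]. *)
Lemma same_side a b f g u eta x y : C1_oo a b f g -> 0 < eta ->
  a <= x -> y <= b ->
  (forall t, t \in `]x, y[ -> f t != u + eta /\ f t != u - eta) ->
  (forall t, t \in `]x, y[ -> eta <= `|f t - u|) \/
  (forall t, t \in `]x, y[ -> `|f t - u| <= eta).
Proof.
move=> fg eta0 ax yb nf.
have [|/existsNP[s /not_implyP[sxy /negP]]] :=
  pselect (forall t, t \in `]x, y[ -> eta <= `|f t - u|); first by left.
rewrite -ltNge ltr_norml => /andP[s1 s2]; right=> t txy; rewrite leNgt; apply/negP => ft.
move: (sxy) (txy); rewrite !in_itv/= => sxy' txy'.
have mM : Num.min s t <= Num.max s t by rewrite ge_min le_max lexx.
have am : a < Num.min s t by rewrite lt_min; lra.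
have Mb : Num.max s t < b by rewrite gt_max; lra.
have sub w : w \in `[Num.min s t, Num.max s t] -> w \in `]x, y[.
  by rewrite !in_itv/=; have [|] := leP s t => ? ?; lra.
have : f t < u - eta \/ u + eta < f t.
  by move: ft; rewrite ltr_normr => /orP[?|?]; [right|left]; lra.
case=> h.
  have [|w /sub/nf[_ /eqP//]] := IVT (v := u - eta) mM (C1_oo_within fg am Mb).
  by have [|] := leP s t => st; rewrite ge_min le_max; apply/andP; split; apply/orP; solve [left; lra|right; lra].
have [|w /sub/nf[/eqP + _] //] := IVT (v := u + eta) mM (C1_oo_within fg am Mb).
by have [|] := leP s t => st; rewrite ge_min le_max; apply/andP; split; apply/orP; solve [left; lra|right; lra].
Qed.

(** A path with finitely many crossings of [u + eta] and [u - eta] stops crossing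
    them close enough to the end, even if it oscillates there. *)
Lemma boundary_dichotomy_left a b f g u eta : a < b -> C1_oo a b f g -> 0 < eta ->
  (crossings `]a, b[ f (u + eta) < +oo)%E ->
  (crossings `]a, b[ f (u - eta) < +oo)%E ->
  (\forall t \near a^'+, eta <= `|f t - u|) \/
  (\forall t \near a^'+, `|f t - u| <= eta).
Proof.
move=> ab fg eta0 f1 f2.
have nab : \forall t \near a^'+, t \in `]a, b[.
  near=> t; rewrite in_itv/=; apply/andP; split; near: t; [exact: nbhs_right_gt|exact: nbhs_right_lt].
have nx x : x \in `]a, b[ -> \forall t \near a^'+, t != x.
  rewrite in_itv/= => /andP[ax _]; near=> t.
  by rewrite lt_eqF//; near: t; exact: nbhs_right_lt.
have : \forall t \near a^'+, [/\ t \in `]a, b[, f t != u + eta & f t != u - eta].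
  have n1 : \forall t \near a^'+, f t != u + eta by exact: finite_crossings_near f1 nx nab.
  have n2 : \forall t \near a^'+, f t != u - eta by exact: finite_crossings_near f2 nx nab.
  by near=> t; split; near: t.
rewrite near_withinE => /nbhs_ballP[e /= e0 B].
have B' t : t \in `]a, (a + e)[ -> [/\ t \in `]a, b[, f t != u + eta & f t != u - eta].
  rewrite in_itv/= => ?; apply: B; last by lra.
  by rewrite /ball/= ltr_distl; apply/andP; split; lra.
have nJ : \forall t \near a^'+, t \in `]a, Num.min (a + e) b[.
  near=> t; rewrite in_itv/= lt_min; apply/and3P; split; near: t.
  - exact: nbhs_right_gt.
  - by apply: nbhs_right_lt; rewrite ltrDl.
  - exact: nbhs_right_lt.
have JB t : t \in `]a, Num.min (a + e) b[ -> t \in `]a, (a + e)[.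
  by rewrite !in_itv/= lt_min => /and3P[-> ->].
have [| | |h|h] := @same_side a b f g u eta a (Num.min (a + e) b) fg eta0.
- by [].
- by rewrite ge_min lexx orbT.
- by move=> t /JB/B'[].
- by left; apply: filterS nJ.
- by right; apply: filterS nJ.
Unshelve. all: by end_near. Qed.

Lemma boundary_dichotomy_right a b f g u eta : a < b -> C1_oo a b f g -> 0 < eta ->
  (crossings `]a, b[ f (u + eta) < +oo)%E ->
  (crossings `]a, b[ f (u - eta) < +oo)%E ->
  (\forall t \near b^'-, eta <= `|f t - u|) \/
  (\forall t \near b^'-, `|f t - u| <= eta).
Proof.
move=> ab fg eta0 f1 f2.
have nab : \forall t \near b^'-, t \in `]a, b[.
  near=> t; rewrite in_itv/=; apply/andP; split; near: t; [exact: nbhs_left_gt|exact: nbhs_left_lt].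
have nx x : x \in `]a, b[ -> \forall t \near b^'-, t != x.
  rewrite in_itv/= => /andP[_ xb]; near=> t.
  by rewrite gt_eqF//; near: t; exact: nbhs_left_gt.
have : \forall t \near b^'-, [/\ t \in `]a, b[, f t != u + eta & f t != u - eta].
  have n1 : \forall t \near b^'-, f t != u + eta by exact: finite_crossings_near f1 nx nab.
  have n2 : \forall t \near b^'-, f t != u - eta by exact: finite_crossings_near f2 nx nab.
  by near=> t; split; near: t.
rewrite near_withinE => /nbhs_ballP[e /= e0 B].
have B' t : t \in `](b - e), b[ -> [/\ t \in `]a, b[, f t != u + eta & f t != u - eta].
  rewrite in_itv/= => ?; apply: B; last by lra.
  by rewrite /ball/= ltr_distl; apply/andP; split; lra.
have nJ : \forall t \near b^'-, t \in `]Num.max (b - e) a, b[.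
  near=> t; rewrite in_itv/= gt_max -andbA; apply/and3P; split; near: t.
  - by apply: nbhs_left_gt; rewrite ltrBlDr ltrDl.
  - exact: nbhs_left_gt.
  - exact: nbhs_left_lt.
have JB t : t \in `]Num.max (b - e) a, b[ -> t \in `](b - e), b[.
  by rewrite !in_itv/= gt_max -andbA => /and3P[-> _ ->].
have [| | |h|h] := @same_side a b f g u eta (Num.max (b - e) a) b fg eta0.
- by rewrite le_max lexx orbT.
- by [].
- by move=> t /JB/B'[].
- by left; apply: filterS nJ.
- by right; apply: filterS nJ.
Unshelve. all: by end_near. Qed.

Lemma near_right_seq a b (Q : R -> Prop) : a < b -> (\forall t \near a^'+, Q t) ->
  \forall n \near \oo, Q (a + (b - a) / n.+2%:R).
Proof.
move=> ab; rewrite near_withinE => /nbhs_ballP[e /= e0 B].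
apply: filterS (near_lt_mesh (b - a) e0) => n ne.
have h0 : 0 < (b - a) / n.+2%:R by rewrite divr_gt0// subr_gt0.
apply: B; last by rewrite ltrDl.
rewrite /ball/= opprD addrA subrr add0r normrN gtr0_norm//; apply: le_lt_trans ne.
by rewrite ler_pM2l ?subr_gt0// lef_pV2 ?posrE// ler_nat.
Qed.

Lemma near_left_seq a b (Q : R -> Prop) : a < b -> (\forall t \near b^'-, Q t) ->
  \forall n \near \oo, Q (b - (b - a) / n.+2%:R).
Proof.
move=> ab; rewrite near_withinE => /nbhs_ballP[e /= e0 B].
apply: filterS (near_lt_mesh (b - a) e0) => n ne.
have h0 : 0 < (b - a) / n.+2%:R by rewrite divr_gt0// subr_gt0.
apply: B; last by rewrite ltrBlDr ltrDl.
rewrite /ball/= opprB addrCA subrr addr0 gtr0_norm//; apply: le_lt_trans ne.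
by rewrite ler_pM2l ?subr_gt0// lef_pV2 ?posrE// ler_nat.
Qed.

End boundary.

(** * Almost surely the number of crossings is constant near the level *)

Section almost_sure.
Context d (T : measurableType d) (R : realType) (P : probability T R).
Variables (X X' : R -> T -> R) (a b u eps M : R) (C : \bar R).
Hypotheses (ab : (a < b)%R) (mX : forall t, measurable_fun setT (X t)).
Hypothesis XC1 : forall w, C1_oo a b (X^~ w) (X'^~ w).
Hypothesis eps0 : (0 < eps)%R.
Hypothesis law : forall t r : R, t \in `]a, b[ -> (0 < r)%R -> (r < eps)%R ->
  P [set w | (`|X t w - u| <= r)%R] <= (M * r)%:E.

Let N v w : \bar R := crossings `]a, b[ (X^~ w) v.

Lemma measurable_crossings_level v : measurable_fun setT (N v).
Proof.
exact: (@measurable_fun_pair2 _ _ _ _ _ _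
  (fun vw : R * T => crossings `]a, b[ (X^~ vw.2) vw.1) v
  (measurable_crossings_process ab mX XC1)).
Qed.

Lemma crossings_ge0 (I : set R) (f : R -> R) v : 0 <= crossings I f v :> \bar R.
Proof. exact: (@le_size_counting _ _ _ [::]). Qed.

Let meas_near (t r : R) : measurable [set w | (`|X t w - u| <= r)%R].
Proof.
have mf : measurable_fun setT (fun w => `|X t w - u|%R).
  by apply: measurableT_comp => //; apply: measurable_funB.
have := mf measurableT _ (measurable_itv `]-oo, r]); rewrite setTI.
by congr measurable; apply/seteqP; split=> w; rewrite /= in_itv.
Qed.

Hypothesis Cfin : C < +oo.
Hypothesis sq : forall v, (`|v - u| < eps)%R -> \int[P]_w (N v w ^+ 2) <= C.

Lemma negligible_infinite_crossings v : (`|v - u| < eps)%R ->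
  P.-negligible [set w | N v w = +oo].
Proof.
move=> vu.
have : P.-integrable setT (fun w => N v w ^+ 2).
  apply/integrableP; split; first by apply: emeasurable_funM; exact: measurable_crossings_level.
  apply: le_lt_trans Cfin; apply: le_trans (sq vu).
  rewrite le_eqVlt; apply/orP; left; apply/eqP; apply: eq_integral => w _.
  by rewrite gee0_abs// mule_ge0// crossings_ge0.
move=> /integrable_ae => /(_ measurableT).
apply: negligibleS => w /= Nw; rewrite /= Nw => /(_ I).
by rewrite mulyy.
Qed.

Let negligible_pm (eta : R) : (0 < eta)%R -> (eta < eps)%R ->
  P.-negligible ([set w | N (u + eta)%R w = +oo] `|` [set w | N (u - eta)%R w = +oo]).
Proof.
move=> e0 e1; apply: negligibleU; apply: negligible_infinite_crossings.
  by rewrite addrAC subrr add0r gtr0_norm.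
by rewrite addrAC subrr add0r normrN gtr0_norm.
Qed.

(** If a path came back arbitrarily close to [u] near [a], then by
    [boundary_dichotomy_left] it would remain within [eta] of [u] near [a], for
    every [eta]; at a given time this has probability at most [M * eta]. *)
Lemma negligible_boundary_left : P.-negligible
  [set w | ~ exists2 eta : R, (0 < eta)%R & \forall t \near a^'+, (eta <= `|X t w - u|)%R].
Proof.
apply: (@negligible_liminf _ _ _ _ _ M _ eps0) => eta e0 e1.
exists ([set w | N (u + eta)%R w = +oo] `|` [set w | N (u - eta)%R w = +oo]).
exists (fun n => [set w | (`|X (a + (b - a) / n.+2%:R)%R w - u| <= eta)%R]); split.
- exact: negligible_pm.
- by move=> n; exact: meas_near.
- apply: nearW => n; apply: law => //.
  have h0 : (0 < (b - a) / n.+2%:R)%R by rewrite divr_gt0// subr_gt0.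
  have h1 : ((b - a) / n.+2%:R < b - a)%R.
    by rewrite ltr_pdivrMr// ltr_pMr ?subr_gt0// ltr1n.
  by rewrite in_itv/=; move: (_ / _)%R h0 h1 => h h0 h1; apply/andP; split; lra.
move=> w /= nw; have [?|N1] := eqVneq (N (u + eta)%R w) +oo; first by left; left.
have [?|N2] := eqVneq (N (u - eta)%R w) +oo; first by left; right.
rewrite -ltey in N1; rewrite -ltey in N2; right.
case: (boundary_dichotomy_left ab (XC1 w) e0 N1 N2).
  by move=> h; exfalso; apply: nw; exists eta.
exact: near_right_seq.
Qed.

Lemma negligible_boundary_right : P.-negligible
  [set w | ~ exists2 eta : R, (0 < eta)%R & \forall t \near b^'-, (eta <= `|X t w - u|)%R].
Proof.
apply: (@negligible_liminf _ _ _ _ _ M _ eps0) => eta e0 e1.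
exists ([set w | N (u + eta)%R w = +oo] `|` [set w | N (u - eta)%R w = +oo]).
exists (fun n => [set w | (`|X (b - (b - a) / n.+2%:R)%R w - u| <= eta)%R]); split.
- exact: negligible_pm.
- by move=> n; exact: meas_near.
- apply: nearW => n; apply: law => //.
  have h0 : (0 < (b - a) / n.+2%:R)%R by rewrite divr_gt0// subr_gt0.
  have h1 : ((b - a) / n.+2%:R < b - a)%R.
    by rewrite ltr_pdivrMr// ltr_pMr ?subr_gt0// ltr1n.
  by rewrite in_itv/=; move: (_ / _)%R h0 h1 => h h0 h1; apply/andP; split; lra.
move=> w /= nw; have [?|N1] := eqVneq (N (u + eta)%R w) +oo; first by left; left.
have [?|N2] := eqVneq (N (u - eta)%R w) +oo; first by left; right.
rewrite -ltey in N1; rewrite -ltey in N2; right.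
case: (boundary_dichotomy_right ab (XC1 w) e0 N1 N2).
  by move=> h; exfalso; apply: nw; exists eta.
exact: near_left_seq.
Qed.

(** Bulinskaya's argument: if [X t w = u] and [X' t w = 0], then at the grid
    point before [t] the path is within [eta * mesh] of [u] as soon as the mesh is
    fine enough for this path. For each of the [n.+1] grid points this has
    probability at most [M * eta * mesh], hence at most [M * (d' - c) * eta] in
    total. *)
Lemma negligible_critical_co c d' : (a < c)%R -> (c < d')%R -> (d' < b)%R ->
  P.-negligible [set w | exists t, [/\ (c <= t < d')%R, X t w = u & X' t w = 0%R]].
Proof.
move=> ac cd db; apply: (@negligible_liminf _ _ _ _ _ (M * (d' - c))%R _ eps0) => eta e0 e1.
exists set0, (fun n => \big[setU/set0]_(k < n.+1)
  [set w | (`|X (gridpt c d' n k) w - u| <= eta * ((d' - c) / n.+1%:R))%R]); split.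
- exact: negligible_set0.
- by move=> n; apply: bigsetU_measurable => k _; exact: meas_near.
- have r0 : (0 < eps / eta)%R by rewrite divr_gt0.
  apply: filterS (near_lt_mesh (d' - c) r0) => n hn.
  have := @Boole_inequality _ _ _ P (fun k : nat =>
    [set w | (`|X (gridpt c d' n k) w - u| <= eta * ((d' - c) / n.+1%:R))%R]) n.+1.
  move=> /(_ (fun k _ => meas_near _ _)) /le_trans; apply.
  apply: (@le_trans _ _ (\sum_(k < n.+1) (M * (eta * ((d' - c) / n.+1%:R)))%:E)).
    apply: lee_sum => k _; apply: law.
    + have /andP[h1 _] := gridpt_itv (ltW cd) (ltnW (ltn_ord k)).
      have /andP[_ h2] := gridpt_itv (ltW cd) (ltnW (ltn_ord k)).
      by rewrite in_itv/= (lt_le_trans ac h1) (le_lt_trans h2 db).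
    + by rewrite mulr_gt0// divr_gt0// subr_gt0.
    + by rewrite mulrC -ltr_pdivlMr.
  rewrite sumEFin lee_fin sumr_const card_ord -[(_ *+ _)%R]mulr_natr.
  have n0 : (n.+1%:R != 0 :> R)%R by [].
  by rewrite le_eqVlt; apply/orP; left; apply/eqP; field.
move=> w [t [tcd Xt X't]]; right.
have := C1_oo_unif (XC1 w) ac db e0; rewrite near_withinE => /nbhs_ballP [r /= r0 B].
have r2 : (0 < r / 2)%R by rewrite divr_gt0.
apply: filterS (near_lt_mesh (d' - c) r2) => n hn.
have [k tk] := mem_cell n tcd.
rewrite -bigcup_seq; exists k => /=; first by rewrite mem_index_enum.
have /andP[h1 h2] := gridpt_itv (ltW cd) (ltnW (ltn_ord k)).
have {tk} /andP[k1 k2] : (gridpt c d' n k <= t < gridpt c d' n k + (d' - c) / n.+1%:R)%R.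
  by move: tk; rewrite /cell/= in_itv/= gridptS.
have [||s] := C1_oo_MVT (XC1 w) _ _ k1; first exact: lt_le_trans h1.
  by case/andP: tcd => _ ?; exact: lt_trans db.
rewrite Xt in_itv/= => /andP[s1 s2] uE.
rewrite distrC uE normrM; apply: ler_pM => //; last first.
  by rewrite ger0_norm ?subr_ge0// lerBlDl ltW.
have tcd' : t \in `[c, d'] by rewrite in_itv/=; move: tcd => /andP[-> /ltW].
have st : (`|t - s| < r / 2)%R.
  rewrite ger0_norm ?subr_ge0//; apply: le_lt_trans hn.
  by rewrite lerBlDr (le_trans (ltW k2))// addrC lerD2l.
have := B (r / 2)%R _ _ t s tcd' st; rewrite X't sub0r normrN; apply => //.
by rewrite /ball/= sub0r normrN gtr0_norm// ltr_pdivrMr// ltr_pMr// ltr1n.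
Qed.

Lemma negligible_critical :
  P.-negligible [set w | exists t, [/\ t \in `]a, b[, X t w = u & X' t w = 0%R]].
Proof.
have : P.-negligible (\bigcup_n [set w | exists t,
    [/\ (lo a b n <= t < hi a b n)%R, X t w = u & X' t w = 0%R]]).
  apply: negligible_bigcup => n; have [h1 h2 h3] := lo_hi n ab.
  exact: negligible_critical_co.
apply: negligibleS => w [t [tab Xt X't]].
have [n _ /(_ n (leqnn n)) nt] := near_lo_hi ab tab.
by exists n => //; exists t.
Qed.

Lemma negligible_not_locally_constant :
  P.-negligible [set w | ~ \forall v \near u, N v w = N u w].
Proof.
have uu : (`|u - u| < eps)%R by rewrite subrr normr0.
have := negligibleU (negligibleU negligible_boundary_left negligible_boundary_right)
  (negligibleU negligible_critical (negligible_infinite_crossings uu)).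
apply: negligibleS => w /= nw; apply: contrapT => /not_orP[/not_orP[/contrapT n1 /contrapT n2] /not_orP[n3 n4]].
apply: nw; case: n1 => e1 e10 n1; case: n2 => e2 e20 n2.
apply: (@crossings_locally_constant _ a b _ (X'^~ w) u (Num.min e1 e2)%R) => //.
- by rewrite ltey; apply/eqP.
- by move=> t tab Xt; apply/eqP => X't; apply: n3; exists t.
- by rewrite lt_min e10.
- by apply: filterS n1 => t; apply: le_trans; rewrite ge_min lexx.
- by apply: filterS n2 => t; apply: le_trans; rewrite ge_min lexx orbT.
Qed.

End almost_sure.

(** * Continuity of the expected number of crossings *)

Section expectation_continuity.
Context d (T : measurableType d) (R : realType) (P : probability T R).
Variables (N : R -> T -> \bar R) (u eps c : R).
Hypotheses (mN : forall v, measurable_fun setT (N v)) (N0 : forall v w, 0 <= N v w).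
Hypothesis eps0 : (0 < eps)%R.
Hypothesis sq : forall v, (`|v - u| < eps)%R -> \int[P]_w (N v w ^+ 2) <= c%:E.
Hypothesis lc : P.-negligible [set w | ~ \forall v \near u, N v w = N u w].

Let J (K : R) v := \int[P]_w mine (N v w) K%:E.

Let mJ (K : R) v : measurable_fun setT (fun w => mine (N v w) K%:E).
Proof. by apply: measurable_mine. Qed.

Let J_ge0 (K : R) v : (0 < K)%R -> 0 <= J K v.
Proof. by move=> K0; apply: integral_ge0 => w _; rewrite le_min N0 lee_fin ltW. Qed.

Let J_le (K : R) v : (0 < K)%R -> J K v <= \int[P]_w N v w.
Proof.
move=> K0; apply: ge0_le_integral => //.
- by move=> w _; rewrite le_min N0 lee_fin ltW.
- by move=> w _; rewrite ge_min lexx.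
Qed.

Let J_bound (K : R) v : (0 < K)%R -> J K v <= K%:E.
Proof.
move=> K0; apply: (@le_trans _ _ (\int[P]_w (cst K%:E w))).
  apply: ge0_le_integral => //.
  - by move=> w _; rewrite le_min N0 lee_fin ltW.
  - by move=> w _; rewrite ge_min lexx orbT.
by rewrite integral_cst// [X in _ * X]probability_setT mule1.
Qed.

Let J_fin (K : R) v : (0 < K)%R -> J K v \is a fin_num.
Proof.
by move=> K0; rewrite ge0_fin_numE ?J_ge0//; exact: le_lt_trans (J_bound v K0) (ltry _).
Qed.

(** For [x > K] one has [x <= x ^ 2 / K]. *)
Let le_trunc (x : \bar R) (K : R) : 0 <= x -> (0 < K)%R -> x <= mine x K%:E + K^-1%:E * x ^+ 2.
Proof.
move=> + K0; case: x => [r| |]//; last first.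
  rewrite (_ : +oo ^+ 2 = +oo) ?mulyy//; by rewrite gt0_muley ?lte_fin ?invr_gt0// addey ?leey// /mine; case: ifP.
rewrite lee_fin => r0; rewrite -EFin_min -EFin_expe -EFinM -EFinD lee_fin.
have [rK|Kr] := leP r K; first by rewrite lerDl mulr_ge0 ?invr_ge0 ?sqr_ge0// ltW.
apply: ler_wpDl; first exact: ltW.
by rewrite mulrC ler_pdivlMr// expr2 ler_wpM2l// ltW.
Qed.

Let le_J (K : R) v : (0 < K)%R -> (`|v - u| < eps)%R ->
  \int[P]_w N v w <= J K v + (K^-1 * c)%:E.
Proof.
move=> K0 vu.
have mN2 : measurable_fun setT (fun w => N v w ^+ 2) by exact: emeasurable_funM.
have N20 w : 0 <= N v w ^+ 2 by rewrite mule_ge0.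
have mKN2 : measurable_fun setT (fun w => K^-1%:E * N v w ^+ 2).
  by apply: measurable_funeM.
have K10 : 0 <= K^-1%:E :> \bar R by rewrite lee_fin invr_ge0 ltW.
apply: (@le_trans _ _ (\int[P]_w (mine (N v w) K%:E + K^-1%:E * N v w ^+ 2))).
  apply: ge0_le_integral => //.
  - exact: emeasurable_funD.
  - by move=> w _; exact: le_trunc.
rewrite ge0_integralD//; last 2 first.
- by move=> w _; rewrite le_min N0 lee_fin ltW.
- by move=> w _; rewrite mule_ge0.
by rewrite leeD2l// ge0_integralZl// EFinM lee_wpmul2l// sq.
Qed.

Let J_cont (K : R) : (0 < K)%R -> fine (J K v) @[v --> u] --> fine (J K u).
Proof.
move=> K0; apply/(@cvg_nbhsP _ R^o) => un unu.
have [| | |_ _ H] := @dominated_convergence _ _ _ P setT measurableT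
  (fun n w => mine (N (un n) w) K%:E) (fun w => mine (N u w) K%:E) (cst K%:E)
  (fun n => mJ K (un n)) (mJ K u) _ _ _.
- apply: negligibleS lc => w /= nw h; apply: nw => _.
  apply: cvg_near_cst; have : \forall n \near \oo, N (un n) w = N u w by exact: unu h.
  by apply: filterS => n ->.
- apply/integrableP; split => //.
  rewrite (_ : (fun _ => _) = cst `|K%:E|)//.
  by rewrite integral_cst// [X in _ * X]probability_setT mule1 ltry.
- apply: aeW => w n _; rewrite gee0_abs ?le_min ?N0 ?lee_fin ?(ltW K0)//.
  by rewrite ge_min lexx orbT.
by apply: fine_cvg; rewrite fineK ?J_fin//; exact: H.
Qed.

Lemma expectation_fin v : (`|v - u| < eps)%R -> \int[P]_w N v w \is a fin_num.
Proof.
move=> vu; rewrite ge0_fin_numE ?integral_ge0//.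
apply: le_lt_trans (le_J ltr01 vu) _.
by rewrite lte_add_pinfty ?ltry//; exact: le_lt_trans (J_bound v ltr01) (ltry _).
Qed.

(** The second moments make the family uniformly integrable: up to [c / K] the
    expectations are those of the variables truncated at [K], to which dominated
    convergence applies. *)
Lemma expectation_near (e : R) : (0 < e)%R -> \forall v \near u,
  \int[P]_w N v w <= \int[P]_w N u w + e%:E /\
  \int[P]_w N u w <= \int[P]_w N v w + e%:E.
Proof.
move=> e0.
have uu : (`|u - u| < eps)%R by rewrite subrr normr0.
have c0 : (0 <= c)%R.
  by rewrite -lee_fin (le_trans _ (sq uu))// integral_ge0// => w _; rewrite mule_ge0.
(* the tail bound [c / K] is then at most [e / 2]; [c] may be 0, hence [c + 1] *)
pose K : R := (2 * (c + 1) / e)%R.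
have K0 : (0 < K)%R by rewrite divr_gt0// mulr_gt0// ltr_wpDl.
have Kc : (K^-1 * c <= e / 2)%R.
  rewrite /K invf_div mulrAC ler_pdivrMr ?mulr_gt0 ?ltr_wpDl//.
  have -> : (e / 2 * (2 * (c + 1)) = e * (c + 1))%R by field.
  by rewrite ler_pM2l// lerDl.
have e20 : (0 < e / 2)%R by rewrite divr_gt0.
have /cvgrPdist_lt/(_ _ e20) H := J_cont K0.
have neps : \forall v \near u, (`|v - u| < eps)%R.
  by apply/nbhs_ballP; exists eps => // y; rewrite /ball/= distrC.
apply: filterS2 neps H => v veps /=; rewrite ltr_distl => /andP[h1 h2].
have step x y : (`|x - u| < eps)%R -> (fine (J K x) <= fine (J K y) + e / 2)%R ->
    \int[P]_w N x w <= \int[P]_w N y w + e%:E.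
  move=> xeps xy; apply: (le_trans (le_J K0 xeps)).
  apply: (@le_trans _ _ (J K y + (e / 2)%:E + (e / 2)%:E)).
    apply: leeD; last by rewrite lee_fin.
    by rewrite -(fineK (J_fin x K0)) -(fineK (J_fin y K0)) -EFinD lee_fin.
  by rewrite -addeA -EFinD -splitr leeD2r// J_le.
by split; apply: step => //; lra.
Qed.

End expectation_continuity.

(** * Expectation of the area formula *)

Section tonelli_setX.
Context d1 d2 (T1 : measurableType d1) (T2 : measurableType d2) (R : realType).
Variables (m1 : {sigma_finite_measure set T1 -> \bar R})
  (m2 : {sigma_finite_measure set T2 -> \bar R}).
Variables (D1 : set T1) (D2 : set T2) (f : T1 * T2 -> \bar R).
Hypotheses (mD1 : measurable D1) (mD2 : measurable D2).
Hypothesis mf : measurable_fun (D1 `*` D2) f.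
Hypothesis f0 : forall x, (D1 `*` D2) x -> 0 <= f x.

Let g := f \_ (D1 `*` D2).

Let mg : measurable_fun setT g.
Proof. by apply/(measurable_restrictT _ _).1 => //; exact: measurableX. Qed.

Let g0 x : 0 <= g x.
Proof. by rewrite /g patchE; case: ifPn => // /set_mem /f0. Qed.

Let integral_snd x : x \in D1 ->
  \int[m2]_y g (x, y) = \int[m2]_(y in D2) f (x, y).
Proof.
move=> xD; rewrite [RHS]integral_mkcond; apply: eq_integral => y _.
by rewrite /g !patchE in_setX/= xD.
Qed.

Let integral_fst y : y \in D2 ->
  \int[m1]_x g (x, y) = \int[m1]_(x in D1) f (x, y).
Proof.
move=> yD; rewrite [RHS]integral_mkcond; apply: eq_integral => x _.
by rewrite /g !patchE in_setX/= yD andbT.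
Qed.

Lemma measurable_integral_snd :
  measurable_fun D1 (fun x => \int[m2]_(y in D2) f (x, y)).
Proof.
apply: (@eq_measurable_fun _ _ _ _ _ (fun x => \int[m2]_y g (x, y))).
  exact: integral_snd.
by apply: measurable_funTS; exact: measurable_fun_fubini_tonelli_F.
Qed.

Lemma measurable_integral_fst :
  measurable_fun D2 (fun y => \int[m1]_(x in D1) f (x, y)).
Proof.
apply: (@eq_measurable_fun _ _ _ _ _ (fun y => \int[m1]_x g (x, y))).
  exact: integral_fst.
by apply: measurable_funTS; exact: measurable_fun_fubini_tonelli_G.
Qed.

Lemma tonelli_setX :
  \int[m1]_(x in D1) \int[m2]_(y in D2) f (x, y) =
  \int[m2]_(y in D2) \int[m1]_(x in D1) f (x, y).
Proof.
transitivity (\int[m1]_x \int[m2]_y g (x, y)).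
  rewrite integral_mkcond; apply: eq_integral => x _; rewrite patchE.
  case: ifPn => [/integral_snd//|xD].
  by rewrite integral0_eq// => y _; rewrite /g patchE in_setX/= (negbTE xD).
rewrite fubini_tonelli// [RHS]integral_mkcond; apply: eq_integral => y _.
rewrite patchE; case: ifPn => [/integral_fst//|yD].
by rewrite integral0_eq// => x _; rewrite /g patchE in_setX/= (negbTE yD) andbF.
Qed.

End tonelli_setX.

Section averages.
Context {R : realType}.
Local Notation mu := (@lebesgue_measure R).

Lemma average_cvg (m : R -> \bar R) (u : R) : measurable_fun setT m ->
  (forall v, 0 <= m v) -> m u \is a fin_num ->
  (forall e : R, (0 < e)%R -> \forall v \near u, m v <= m u + e%:E /\ m u <= m v + e%:E) ->
  ((2 * delta)^-1)%R%:E * \int[mu]_(v in `[(u - delta)%R, (u + delta)%R]%classic) m v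
    @[delta --> 0^'+] --> m u.
Proof.
move=> mm m0 mfin mc.
have H (e : R) : (0 < e)%R -> \forall delta \near 0^'+,
    m u - e%:E <= ((2 * delta)^-1)%R%:E *
      \int[mu]_(v in `[(u - delta)%R, (u + delta)%R]%classic) m v <= m u + e%:E.
  move=> e0; have /nbhs_ballP[r /= r0 B] := mc e e0.
  near=> delta.
  have d0 : (0 < delta)%R by near: delta; exact: nbhs_right_gt.
  have dr : (delta < r)%R by near: delta; exact: nbhs_right_lt.
  have muB : mu `[(u - delta)%R, (u + delta)%R]%classic = (2 * delta)%:E.
    rewrite lebesgue_measure_itv/= lte_fin ifT; last by lra.
    by rewrite -EFinB; congr (_%:E); lra.
  have mcst (k : R) : \int[mu]_(v in `[(u - delta)%R, (u + delta)%R]%classic) cst k%:E v = (k * (2 * delta))%:E.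
    by rewrite integral_cst ?[X in _ * X]muB//; exact: measurable_itv.
  have in_r v : `[(u - delta)%R, (u + delta)%R]%classic v -> ball u r v.
    by rewrite /= in_itv/= /ball/= ltr_distl => /andP[h1 h2]; apply/andP; split; lra.
  have mB : measurable_fun `[(u - delta)%R, (u + delta)%R]%classic m by exact: measurable_funTS.
  have dd0 : (0 < 2 * delta)%R by rewrite mulr_gt0.
  rewrite -(fineK mfin) -EFinB -EFinD muleC lee_pdivlMr// lee_pdivrMr// -!EFinM.
  have mu0 : (0 <= fine (m u))%R by exact: fine_ge0.
  apply/andP; split; last first.
    rewrite -mcst; apply: ge0_le_integral => //.
    by move=> v /in_r/B[+ _]; rewrite /= EFinD fineK.
  have [neg|pos] := ltP (fine (m u) - e)%R 0%R.
    apply: (@le_trans _ _ 0%E); first by rewrite lee_fin mulr_le0_ge0// ltW.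
    exact: integral_ge0.
  rewrite -mcst; apply: ge0_le_integral => //.
  by move=> v /in_r/B[_ +]; rewrite /= EFinB fineK// leeBlDr.
rewrite -(fineK mfin); apply/fine_cvgP; split.
  apply: filterS (H 1%R ltr01) => delta /andP[h1 h2]; rewrite fin_numElt.
  by rewrite (lt_le_trans _ h1) ?(le_lt_trans h2)// -(fineK mfin) ?ltNyr ?ltry.
have near_fine (e : R) (A : \bar R) : m u - e%:E <= A <= m u + e%:E ->
    (`|fine (m u) - fine A| <= e)%R.
  rewrite -(fineK mfin); case: A => [x| |]/=;
    rewrite -?EFinB -?EFinD ?lee_fin ?leye_eq ?leeNy_eq//; last by rewrite andbF.
  by move=> /andP[h1 h2]; rewrite ler_distlC; apply/andP; split; lra.
by apply/cvgrPdist_le => e e0; apply: filterS (H e e0) => delta; exact: near_fine.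
Unshelve. all: by end_near. Qed.

End averages.

Section expected_area.
Context d (T : measurableType d) (R : realType) (P : probability T R).
Variables (X X' : R -> T -> R) (a b : R).
Hypotheses (ab : (a < b)%R) (mX : forall t, measurable_fun setT (X t)).
Hypothesis XC1 : forall w, C1_oo a b (X^~ w) (X'^~ w).
Local Notation mu := (@lebesgue_measure R).

Lemma measurable_weighted_speed (u delta : R) : measurable_fun (`]a, b[ `*` setT)
  (fun tw : R * T => (`|X' tw.1 tw.2| *
     \1_[set v | (`|v - u| <= delta)%R] (X tw.1 tw.2))%:E).
Proof.
have mB : measurable [set v : R | (`|v - u| <= delta)%R].
  rewrite (_ : mkset _ = `[(u - delta)%R, (u + delta)%R]%classic); first exact: measurable_itv.
  by apply/seteqP; split => v; rewrite /= in_itv/= ler_distl.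
apply/measurable_EFinP; apply: measurable_funM.
  by apply: measurableT_comp => //; exact: measurable_derivative_oo.
apply: measurableT_comp; first exact: measurable_indic.
exact: measurable_process_oo.
Qed.

Lemma measurable_expected_speed (u delta : R) : measurable_fun `]a, b[
  (fun t => \int[P]_w (`|X' t w| * \1_[set w' | (`|X t w' - u| <= delta)%R] w)%:E).
Proof.
apply: (@measurable_integral_snd _ _ _ _ _ P `]a, b[%classic setT
  (fun tw : R * T => (`|X' tw.1 tw.2| *
     \1_[set v | (`|v - u| <= delta)%R] (X tw.1 tw.2))%:E)) => //.
exact: measurable_weighted_speed.
Qed.

(** Tonelli's theorem on both sides of the pathwise area formula. *)
Lemma expected_area (u delta : R) :
  \int[mu]_(t in `]a, b[) \int[P]_w (`|X' t w| * \1_[set w' | (`|X t w' - u| <= delta)%R] w)%:E =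
  \int[mu]_(v in `[(u - delta)%R, (u + delta)%R]) \int[P]_w crossings `]a, b[ (X^~ w) v.
Proof.
pose f (tw : R * T) := (`|X' tw.1 tw.2| * \1_[set v | (`|v - u| <= delta)%R] (X tw.1 tw.2))%:E : \bar R.
transitivity (\int[mu]_(t in `]a, b[) \int[P]_w f (t, w)) => //.
rewrite (tonelli_setX mu P)//; last 2 first.
- exact: measurable_weighted_speed.
- by move=> x _; rewrite lee_fin mulr_ge0.
transitivity (\int[P]_w \int[mu]_(v in `[(u - delta)%R, (u + delta)%R]) crossings `]a, b[ (X^~ w) v).
  apply: eq_integral => w _; rewrite -(area_formula ab (XC1 w)).
  rewrite integral_mkcondr; apply: eq_integral => t _; rewrite /f patchE/= indicE.
  have -> : (t \in X^~ w @^-1` `[(u - delta)%R, (u + delta)%R]) =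
      (X t w \in [set v | (`|v - u| <= delta)%R]).
    by apply/idP/idP => /set_mem h; apply/mem_set; move: h; rewrite /= in_itv/= ler_distl.
  by case: (_ \in _); rewrite ?mulr1 ?mulr0.
have := @tonelli_setX _ _ _ _ _ mu P `[(u - delta)%R, (u + delta)%R]%classic setT
  (fun vw : R * T => crossings `]a, b[ (X^~ vw.2) vw.1).
move=> -> //.
- by apply: measurable_funTS; exact: measurable_crossings_process.
Qed.

End expected_area.

(** * From an interval to its interior, and bounds from the density *)

Section interval_interior.
Context {R : realType}.
Implicit Types (I : set R) (a b v : R).
Local Notation mu := (@lebesgue_measure R).

Lemma bounded_interval_ends I : is_interval I -> bounded_set I ->
  exists a b, `]a, b[ `<=` I /\ I `<=` `[a, b].
Proof.
move=> iI [M0 [_ /(_ (M0 + 1)%R)]]; rewrite ltrDl => /(_ ltr01) hM.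
have [I0|/set0P I0] := eqVneq I set0.
  by exists 0%R, 0%R; rewrite I0; split => // t; rewrite /= in_itv/=; lra.
have ubI : has_sup I.
  by split=> //; exists (M0 + 1)%R => x /hM; apply: le_trans; exact: ler_norm.
have lbI : has_inf I.
  split=> //; exists (- (M0 + 1))%R => x /hM; rewrite /= lerNl; apply: le_trans.
  by rewrite -normrN; exact: ler_norm.
exists (inf I), (sup I); split=> [t|t It]; last first.
  rewrite /= in_itv/=; apply/andP; split.
    by apply: ge_inf => //; case: lbI.
  by apply: ub_le_sup => //; case: ubI.
rewrite /= in_itv/= => /andP[ti ts].
have ti' : (0 < t - inf I)%R by rewrite subr_gt0.
have ts' : (0 < sup I - t)%R by rewrite subr_gt0.
have [x Ix xt] := inf_adherent ti' lbI.
have [y Iy ty] := sup_adherent ts' ubI.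
by apply: (iI x y) => //; apply/andP; split; lra.
Qed.

Section ends.
Variables (I : set R) (a b : R).
Hypotheses (sub1 : `]a, b[ `<=` I) (sub2 : I `<=` `[a, b]).

Let E := I `\` `]a, b[.

Let E_countable (S : set R) : S `<=` E -> countable S.
Proof.
move=> SE; apply: (@sub_countable _ _ _ [set a; b]); last exact: finite_set_countable.
apply: subset_card_le => t /SE[/sub2]; rewrite /= !in_itv/= => /andP[at' tb] /negP.
rewrite negb_and -!leNgt => /orP[ta|bt]; [left|right]; lra.
Qed.

Let mE : measurable E.
Proof. by apply: countable_measurable; [exact: measurable_set1|exact: E_countable]. Qed.

Let IE : I = `]a, b[ `|` E.
Proof. by rewrite /E setDUK. Qed.

Lemma measurable_interval : measurable I.
Proof. by rewrite IE; apply: measurableU => //; exact: measurable_itv. Qed.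

Lemma integral_interior (g : R -> \bar R) : measurable_fun `]a, b[ g ->
  (forall t, 0 <= g t) -> \int[mu]_(t in I) g t = \int[mu]_(t in `]a, b[) g t.
Proof.
move=> mg g0.
have mgE : measurable_fun E g.
  move=> _ Y mY; apply: countable_measurable; first exact: measurable_set1.
  by apply: E_countable => t [].
rewrite {1}IE ge0_integral_setU//; last 2 first.
- by apply/measurable_funU => //; exact: measurable_itv.
- by rewrite disj_set2E /E setDIK.
rewrite [X in _ + X](_ : _ = 0) ?adde0//; apply: null_set_integral => //.
by apply: countable_lebesgue_measure0; exact: E_countable.
Qed.

Lemma crossings_singleton (f : R -> R) x v :
  counting [set t | [set x] t /\ (I x /\ f x = v)] = (`[< I x /\ f x = v >] : bool)%:R%:E :> \bar R.
Proof.
have [h|h] := pselect (I x /\ f x = v).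
  rewrite asboolT// (_ : mkset _ = [set x]); last by apply/seteqP; split=> [t []|t].
  by rewrite /counting asboolT// fset_set1 cardfs1.
rewrite asboolF// (_ : mkset _ = set0); last by apply/seteqP; split=> [t []|].
by rewrite /counting asboolT// fset_set0.
Qed.

(** In this form the difference between the two counts is visibly measurable in
    the outcome, and null almost surely when the values at the end points have
    densities. *)
Lemma crossings_interior (f g : R -> R) v : (a < b)%R -> C1_oo a b f g ->
  crossings I f v = crossings `]a, b[ f v + (`[< I a /\ f a = v >] : bool)%:R%:E
    + (`[< I b /\ f b = v >] : bool)%:R%:E :> \bar R.
Proof.
move=> ab fg; rewrite -!crossings_singleton /crossings.
have m1 : measurable [set t | `]a, b[%classic t /\ f t = v].
  have := measurable_preim fg (@subset_refl _ _) (measurable_itv _) (measurable_set1 v).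
  by [].
have m2 x : measurable [set t | [set x] t /\ (I x /\ f x = v)].
  apply: countable_measurable; first exact: measurable_set1.
  apply: (@sub_countable _ _ _ [set x]); last exact: finite_set_countable.
  by apply: subset_card_le => t [].
rewrite -measureU//; last first.
  rewrite -subset0 => t [[tab _] [ta _]].
  by move: tab; rewrite ta /= in_itv/= ltxx.
rewrite -measureU//; last 2 first.
- exact: measurableU.
- rewrite -subset0 => t [[[tab _]|[ta _]] [tb _]].
    by move: tab; rewrite tb /= in_itv/= ltxx andbF.
  by move: ab; rewrite -ta -tb ltxx.
congr counting; apply/seteqP; split=> t /=.
  move=> [It ft]; have := sub2 It; rewrite /= in_itv/= => /andP[].
  rewrite le_eqVlt => /orP[/eqP ta _|at']; first by left; right; rewrite ta.
  rewrite le_eqVlt => /orP[/eqP tb|tb]; first by right; rewrite -tb.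
  by left; left; rewrite in_itv/= at'.
by move=> [[[tab ft]|[-> //]]|[-> //]]; split => //; exact: sub1.
Qed.

End ends.
End interval_interior.

Section density.
Context d (T : measurableType d) (R : realType) (P : probability T R).
Variables (Y : {RV P >-> R}) (p : R -> R) (u eps M : R).
Hypothesis dp : has_density Y p.
Local Notation mu := (@lebesgue_measure R).

Lemma density_point v : P [set w | Y w = v] = 0.
Proof.
have [_ _ /(_ [set v] (measurable_set1 v))] := dp.
by rewrite integral_set1.
Qed.

Lemma density_near r : (forall v, (`|v - u| < eps)%R -> (p v <= M)%R) ->
  (0 < r)%R -> (r < eps)%R -> P [set w | (`|Y w - u| <= r)%R] <= (2 * M * r)%:E.
Proof.
move=> pM r0 re; have [mp p0 law] := dp.
have bE : [set v : R | (`|v - u| <= r)%R] = `[(u - r)%R, (u + r)%R]%classic.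
  by apply/seteqP; split => v; rewrite /= in_itv/= ler_distl.
have -> : P [set w | (`|Y w - u| <= r)%R] = distribution P Y `[(u - r)%R, (u + r)%R]%classic.
  by rewrite -bE.
rewrite law; last exact: measurable_itv.
apply: (@le_trans _ _ (\int[mu]_(x in `[(u - r)%R, (u + r)%R]) cst M%:E x)).
  apply: ge0_le_integral => //.
  - by move=> x _; rewrite lee_fin.
  - by apply/measurable_EFinP; exact: measurable_funTS.
  - move=> x; rewrite -bE /= => xr; rewrite lee_fin; apply: pM.
    exact: le_lt_trans re.
rewrite integral_cst; last exact: measurable_itv.
rewrite [X in _ * X]lebesgue_measure_itv/= lte_fin ifT; last by lra.
by rewrite -EFinB -EFinM lee_fin; lra.
Qed.

End density.

(** * The limit of the averaged speed near the level *)

Section endpoints.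
Context d (T : measurableType d) (R : realType) (P : probability T R).
Variables (I : set R) (X : R -> {RV P >-> R}) (p : R -> R -> R).

Let endpointE x v : I x -> (fun w => (`[< I x /\ X x w = v >] : bool)%:R%:E : \bar R) =
  EFin \o \1_[set w | X x w = v].
Proof.
move=> Ix; apply/funext => w; rewrite /= indicE; congr ((nat_of_bool _)%:R%:E).
by apply/idP/idP => [/asboolP[_ h]|/set_mem h]; [exact/mem_set|apply/asboolP].
Qed.

Let endpoint0 x v : ~ I x ->
  (fun w => (`[< I x /\ X x w = v >] : bool)%:R%:E : \bar R) = cst 0.
Proof. by move=> nI; apply/funext => w; rewrite asboolF// => -[]. Qed.

Let mpt x v : measurable [set w | X x w = v].
Proof.
by have := @measurable_funPT _ _ _ _ (X x) measurableT _ (measurable_set1 v); rewrite setTI.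
Qed.

Lemma measurable_endpoint x v :
  measurable_fun setT (fun w => (`[< I x /\ X x w = v >] : bool)%:R%:E : \bar R).
Proof.
have [Ix|nI] := pselect (I x); last by rewrite endpoint0.
by rewrite endpointE//; apply/measurable_EFinP; exact: measurable_indic.
Qed.

Hypothesis dens : forall t, I t -> has_density (X t) (p t).

Lemma expected_endpoint x v :
  \int[P]_w ((`[< I x /\ X x w = v >] : bool)%:R%:E : \bar R) = 0.
Proof.
have [Ix|nI] := pselect (I x); last by rewrite endpoint0// integral0.
by rewrite endpointE// integral_indic// setIT; exact: (density_point (dens Ix)).
Qed.

(** The degenerate index sets: both sides are zero. *)
Lemma first_limit_point (a u : R) : I `<=` [set a] ->
  ((2 * delta)^-1)%R%:E *
     \int[@lebesgue_measure R]_(t in I) 'E_P[fun w => `|process_derive I X t w|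
                     * \1_[set w' | (`|X t w' - u| <= delta)%R] w]%R
     @[delta --> 0^'+]
   --> \int[P]_w process_crossings I X u w.
Proof.
move=> Ia; rewrite [X in _ --> X](_ : _ = 0); last first.
  rewrite -(expected_endpoint a u); apply: eq_integral => w _.
  rewrite -(crossings_singleton I (fun t => X t w) a u) /process_crossings /crossings; congr counting.
  by apply/seteqP; split=> [t [It Xt]|t [-> //]]; have := Ia _ It; move=> <-.
rewrite (_ : (fun _ => _) = cst 0); first exact: cvg_cst.
apply/funext => delta; have [->|->] := subset_set1 Ia.
  by rewrite integral_set0 mule0.
by rewrite integral_set1 mule0.
Qed.

End endpoints.

Section first_limit.
Context d (T : measurableType d) (R : realType) (P : probability T R).
Variables (I : set R) (X : R -> {RV P >-> R}) (p : R -> R -> R) (a b u eps M : R).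
Hypotheses (sub1 : `]a, b[ `<=` I) (sub2 : I `<=` `[a, b]) (ab : (a < b)%R).
Hypothesis eps0 : (0 < eps)%R.
Hypothesis XI : forall w, C1_on I (fun t => X t w).
Hypothesis sup2 : ereal_sup [set \int[P]_w (process_crossings I X v w ^+ 2)
            | v in [set v | (`|v - u| < eps)%R]] < +oo.
Hypothesis dens : forall t, I t -> has_density (X t) (p t).
Hypothesis pM : forall t v, I t -> (`|v - u| < eps)%R -> (p t v <= M)%R.
Local Notation mu := (@lebesgue_measure R).

Let X' (t : R) (w : T) := process_derive I X t w.

Let mX t : measurable_fun setT (X t). Proof. exact: measurable_funPT. Qed.

Let XC1 w : C1_oo a b (fun t => X t w) (X'^~ w).
Proof. exact: (C1_on_oo sub1 (XI w)). Qed.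

Let N v w : \bar R := crossings `]a, b[ (fun t => X t w) v.

Let mN v : measurable_fun setT (N v).
Proof. exact: (measurable_crossings_level ab mX XC1). Qed.

Let endpoint x v w : \bar R := (`[< I x /\ X x w = v >] : bool)%:R%:E.

Let mendpoint x v : measurable_fun setT (endpoint x v).
Proof. exact: measurable_endpoint. Qed.

Let integral_endpoint x v : \int[P]_w endpoint x v w = 0.
Proof. exact: (expected_endpoint dens). Qed.

Let crossE v w : process_crossings I X v w = N v w + endpoint a v w + endpoint b v w.
Proof. exact: (crossings_interior sub1 sub2 v ab (XC1 w)). Qed.

Let endpoint_ge0 x v w : 0 <= endpoint x v w. Proof. by rewrite lee_fin. Qed.

Let N_ge0 v w : 0 <= N v w. Proof. exact: crossings_ge0. Qed.

Let expected_crossings v :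
  \int[P]_w process_crossings I X v w = \int[P]_w N v w.
Proof.
under eq_integral do rewrite crossE.
rewrite ge0_integralD//; last by apply: emeasurable_funD.
  by rewrite ge0_integralD// !integral_endpoint !adde0.
by move=> w _; rewrite adde_ge0.
Qed.

Let C := ereal_sup [set \int[P]_w (process_crossings I X v w ^+ 2)
            | v in [set v | (`|v - u| < eps)%R]].

Let sq v : (`|v - u| < eps)%R -> \int[P]_w (N v w ^+ 2) <= C.
Proof.
move=> vu; apply: (@le_trans _ _ (\int[P]_w (process_crossings I X v w ^+ 2))).
  have mc : measurable_fun setT (process_crossings I X v).
    rewrite (_ : process_crossings I X v = fun w => N v w + endpoint a v w + endpoint b v w).
      by apply: emeasurable_funD => //; exact: emeasurable_funD.
    by apply/funext => w; rewrite crossE.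
  have le w : N v w <= process_crossings I X v w.
    by rewrite crossE -addeA leeDl// adde_ge0.
  apply: ge0_le_integral => //.
  - by move=> w _; rewrite mule_ge0.
  - exact: emeasurable_funM.
  - exact: emeasurable_funM.
  - by move=> w _; apply: lee_pmul.
by apply: ereal_sup_ubound; exists v.
Qed.

Let uu : (`|u - u| < eps)%R. Proof. by rewrite subrr normr0. Qed.

Let C0 : 0 <= C.
Proof. by apply: le_trans (sq uu); apply: integral_ge0 => w _; rewrite mule_ge0. Qed.

Let Cfin : C = (fine C)%:E.
Proof. by rewrite fineK// ge0_fin_numE. Qed.

Let law t r : t \in `]a, b[ -> (0 < r)%R -> (r < eps)%R ->
  P [set w | (`|X t w - u| <= r)%R] <= (2 * M * r)%:E.
Proof.
move=> /sub1 It r0 re; apply: (density_near (dens It) _ r0 re) => v; exact: pM.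
Qed.

Let lc : P.-negligible [set w | ~ \forall v \near u, N v w = N u w].
Proof. exact: (negligible_not_locally_constant ab mX XC1 eps0 law sup2 sq). Qed.

Let sqc v : (`|v - u| < eps)%R -> \int[P]_w (N v w ^+ 2) <= (fine C)%:E.
Proof. by rewrite -Cfin; exact: sq. Qed.

(** The expected speed near [u] is the average of the expected numbers of
    crossings over the levels between [u - delta] and [u + delta], and these depend
    continuously on the level at [u]. *)
Lemma first_limit : ((2 * delta)^-1)%R%:E *
     \int[mu]_(t in I) 'E_P[fun w => `|process_derive I X t w|
                     * \1_[set w' | (`|X t w' - u| <= delta)%R] w]%R
     @[delta --> 0^'+]
   --> \int[P]_w process_crossings I X u w.
Proof.
rewrite expected_crossings.
have E (delta : R) : \int[mu]_(t in I) 'E_P[fun w => `|process_derive I X t w|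
                     * \1_[set w' | (`|X t w' - u| <= delta)%R] w]%R =
   \int[mu]_(v in `[(u - delta)%R, (u + delta)%R]) \int[P]_w N v w.
  rewrite -(expected_area P ab mX XC1 u delta).
  transitivity (\int[mu]_(t in I) \int[P]_w
      (`|X' t w| * \1_[set w' | (`|X t w' - u| <= delta)%R] w)%:E).
    by apply: eq_integral => t _; rewrite unlock.
  apply: (integral_interior sub1 sub2).
    exact: (measurable_expected_speed P ab mX XC1 u delta).
  by move=> t; apply: integral_ge0 => w _; rewrite lee_fin mulr_ge0.
under eq_fun do rewrite E.
apply: average_cvg.
- have := @measurable_fun_fubini_tonelli_F _ _ _ _ _ P
    (fun vw : R * T => crossings `]a, b[ (fun t => X t vw.2) vw.1).
  apply; first exact: (measurable_crossings_process ab mX XC1).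
  by move=> vw; exact: crossings_ge0.
- by move=> v; apply: integral_ge0 => w _; exact: N_ge0.
- exact: (expectation_fin mN N_ge0 sqc uu).
- exact: (expectation_near mN N_ge0 eps0 sqc lc).
Qed.

End first_limit.

(** * Conditional expectations and the Rice function *)

Section density_change.
Context d (T : measurableType d) (R : realType) (P : probability T R).
Variables (Y : {RV P >-> R}) (p : R -> R).
Hypothesis dp : has_density Y p.
Local Notation mu := (@lebesgue_measure R).
Local Notation nu := (distribution P Y).

(** The same function with values in the copy of the real line on which the
    Lebesgue measure is defined. *)
Let Yb : T -> measurableTypeR R := Y.

Let mYb : measurable_fun setT Yb. Proof. exact: (@measurable_funPT _ _ _ _ Y). Qed.

Let Yp : {mfun T >-> measurableTypeR R} :=
  HB.pack Yb (isMeasurableFun.Build _ _ _ _ Yb mYb).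

Let nub := distribution P Yp.

Let density_dominates : nub `<< mu.
Proof.
apply/null_content_dominatesP => A mA A0; have [mp p0 law] := dp.
rewrite [LHS](law A mA).
apply: null_set_integral => //; apply/measurable_EFinP; exact: measurable_funTS.
Qed.

(** [p] is a version of the Radon-Nikodym derivative of the law of [Y]. *)
Lemma integral_density (f : R -> \bar R) (E : set R) : measurable E ->
  measurable_fun setT f -> nu.-integrable E f ->
  \int[nu]_(v in E) f v = \int[mu]_(v in E) (f v * (p v)%:E).
Proof.
move=> mE mf /integrableP[_ fi]; have [mp p0 law] := dp.
have fiP : P.-integrable (Y @^-1` E) (f \o Y).
  apply/integrableP; split.
    by apply: measurable_funTS; exact: measurableT_comp.
  apply: le_lt_trans fi; rewrite [leRHS]ge0_integral_pushforward//.
  by apply: measurable_funTS; exact: measurableT_comp.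
rewrite [LHS]integral_pushforward//.
have fib : nub.-integrable E f by exact: (integrable_pushforward mYb).
transitivity (\int[nub]_(v in E) f v).
  by rewrite [RHS](integral_pushforward mYb).
rewrite -(Radon_Nikodym_change_of_variables density_dominates mE fib).
have mpE : measurable_fun E (EFin \o p) by apply/measurable_EFinP; exact: measurable_funTS.
have iRN := Radon_Nikodym_integrable (nu := charge_of_finite_measure nub) density_dominates.
have mRN := measurable_int _ iRN.
have mfE : measurable_fun E f by exact: measurable_funTS.
apply: ae_eq_integral => //.
- by apply: emeasurable_funM => //; exact: measurable_funTS.
- by apply: emeasurable_funM.
have : ae_eq mu E (Radon_Nikodym (charge_of_finite_measure nub) mu) (EFin \o p).
  apply: integral_ae_eq => //.
    by apply: (integrableS measurableT) => //; exact: iRN.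
  move=> A AE mA; rewrite -(Radon_Nikodym_integral (nu := charge_of_finite_measure nub) density_dominates mA).
  exact: (law A mA).
by apply: filterS => v h vE; rewrite h.
Qed.

End density_change.

Section conditional_expectation.
Context d (T : measurableType d) (R : realType) (P : probability T R).
Variables (Y : {RV P >-> R}) (p e : R -> R) (Z : T -> R).
Hypotheses (dp : has_density Y p) (ce : is_cond_expectation Z Y e).
Hypothesis Z0 : forall w, (0 <= Z w)%R.
Local Notation mu := (@lebesgue_measure R).
Local Notation nu := (distribution P Y).

Let g v : \bar R := (e v * p v)%:E.

Let mg : measurable_fun setT g.
Proof.
have [mp _ _] := dp; have [me _ _] := ce.
by apply/measurable_EFinP; exact: measurable_funM.
Qed.

Lemma integral_cond_density (B : set R) : measurable B ->
  \int[mu]_(v in B) (e v * p v)%:E = \int[P]_(w in Y @^-1` B) (Z w)%:E.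
Proof.
move=> mB; have [me ie ->//] := ce; rewrite (integral_density dp)//.
  exact/measurable_EFinP.
exact: (integrableS measurableT).
Qed.

(** A version of the conditional expectation of [Z >= 0] may be negative on a
    null set for the law of [Y]; after multiplication by [p] this becomes a null
    set for the Lebesgue measure. *)
Lemma integral_cond_density_neg (B : set R) : measurable B ->
  \int[mu]_(v in B) (g^\-)%E v = 0.
Proof.
move=> mB; have [mp p0 law] := dp; have [me _ _] := ce.
have mgn : measurable_fun setT (g^\-)%E by exact: measurable_funeneg.
apply/eqP; rewrite eq_le integral_ge0// andbT.
apply: (@le_trans _ _ (\int[mu]_v (g^\-)%E v)).
  by apply: ge0_subset_integral.
pose A := [set v | (e v < 0)%R].
have mA : measurable A.
  have := me measurableT _ (measurable_itv `]-oo, 0%R[); rewrite setTI.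
  by congr measurable; apply/seteqP; split=> v; rewrite /= in_itv.
have -> : \int[mu]_v (g^\-)%E v = \int[mu]_(v in A) - g v.
  rewrite [RHS]integral_mkcond; apply: eq_integral => v _; rewrite patchE funenegE.
  case: ifPn => [/set_mem vA|/negP vA].
    apply/max_idPl; rewrite leeNr oppe0 lee_fin mulr_le0_ge0// ltW//; exact: vA.
  apply/max_idPr; rewrite leeNl oppe0 lee_fin mulr_ge0// leNgt; apply/negP => h.
  by apply: vA; exact: mem_set.
have gA v : A v -> 0 <= - g v.
  by move=> vA; rewrite leeNr oppe0 lee_fin mulr_le0_ge0// ltW//; exact: vA.
have : \int[mu]_(v in A) g v = - \int[mu]_(v in A) - g v.
  rewrite -integral_ge0N//; apply: eq_integral => v _; by rewrite oppeK.
rewrite integral_cond_density// => h; rewrite -leeN2 -h oppe0.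
by apply: integral_ge0 => w _; rewrite lee_fin.
Qed.

Lemma integral_cond_density_pos (B : set R) : measurable B ->
  \int[mu]_(v in B) (g^\+)%E v = \int[P]_(w in Y @^-1` B) (Z w)%:E.
Proof.
move=> mB; rewrite -integral_cond_density// [RHS]integralE.
by rewrite integral_cond_density_neg// sube0.
Qed.

End conditional_expectation.

Section second_limit.
Context d (T : measurableType d) (R : realType) (P : probability T R).
Variables (I : set R) (X : R -> {RV P >-> R}) (p e : R -> R -> R) (u eps : R).
Hypothesis mI : measurable I.
Hypothesis dens : forall t, I t -> has_density (X t) (p t).
Hypothesis ce : forall t, I t ->
  is_cond_expectation (fun w => `|process_derive I X t w|%R) (X t) (e t).
Hypothesis mep : measurable_fun (I `*` [set v | (`|v - u| < eps)%R])
       (fun tv : R * R => (e tv.1 tv.2 * p tv.1 tv.2)%R).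
Local Notation mu := (@lebesgue_measure R).

(** The integrand of [rice_function] is nonnegative only almost everywhere, so
    Tonelli's theorem is applied to its positive and negative parts; the negative
    part has integral zero, hence does not contribute at almost every level. *)
Lemma integral_rice (delta : R) : (0 < delta)%R -> (delta < eps)%R ->
  \int[mu]_(v in `[(u - delta)%R, (u + delta)%R]%classic) rice_function I p e v =
  \int[mu]_(t in I) 'E_P[fun w => `|process_derive I X t w|
                     * \1_[set w' | (`|X t w' - u| <= delta)%R] w]%R.
Proof.
move=> d0 de; pose B := `[(u - delta)%R, (u + delta)%R]%classic : set R.
have mB : measurable B by exact: measurable_itv.
pose g (tv : R * R) : \bar R := (e tv.1 tv.2 * p tv.1 tv.2)%:E.
have mgB : measurable_fun (I `*` B) g.
  apply/measurable_EFinP; apply: measurable_funS mep.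
    apply: measurableX => //; rewrite (_ : mkset _ = `](u - eps)%R, (u + eps)%R[%classic).
      exact: measurable_itv.
    by apply/seteqP; split=> v; rewrite /= in_itv/= ltr_distl.
  by move=> [t v] [/= It]; rewrite /B /= in_itv/= -ler_distl => h; split => //=; exact: le_lt_trans de.
have nE1 t v : (g^\-)%E (t, v) = ((fun v => (e t v * p t v)%:E)^\-)%E v by rewrite !funenegE.
have pE1 t v : (g^\+)%E (t, v) = ((fun v => (e t v * p t v)%:E)^\+)%E v by rewrite !funeposE.
have nE2 t v : ((fun t => (e t v * p t v)%:E)^\-)%E t = (g^\-)%E (t, v) by rewrite !funenegE.
have pE2 t v : ((fun t => (e t v * p t v)%:E)^\+)%E t = (g^\+)%E (t, v) by rewrite !funeposE.
have mgp : measurable_fun (I `*` B) (g^\+)%E by exact: measurable_funepos.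
have mgn : measurable_fun (I `*` B) (g^\-)%E by exact: measurable_funeneg.
pose Pp v := \int[mu]_(t in I) (g^\+)%E (t, v).
pose Q v := \int[mu]_(t in I) (g^\-)%E (t, v).
have mP : measurable_fun B Pp by exact: (measurable_integral_fst mu mI mB mgp).
have mQ : measurable_fun B Q by exact: (measurable_integral_fst mu mI mB mgn).
have Q0 : \int[mu]_(v in B) Q v = 0.
  rewrite -(tonelli_setX mu mu (f := (g^\-)%E))//.
  apply: integral0_eq => t It.
  under eq_integral do rewrite nE1.
  by apply: (integral_cond_density_neg (dens It) (ce It)).
have RE v : rice_function I p e v = Pp v - Q v.
  rewrite /rice_function integralE; congr (_ - _).
    by apply: eq_integral => t _; rewrite pE2.
  by apply: eq_integral => t _; rewrite nE2.
transitivity (\int[mu]_(v in B) Pp v).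
  apply: ae_eq_integral => //.
  - by rewrite (funext RE); exact: emeasurable_funB.
  - have : ae_eq mu B Q (cst 0).
      apply/ae_eq_integral_abs => //.
      by rewrite -[RHS]Q0; apply: eq_integral => v _; rewrite gee0_abs// integral_ge0.
    apply: filterS => v h vB; rewrite RE.
    by rewrite h// sube0.
rewrite -(tonelli_setX mu mu (f := (g^\+)%E))//.
apply: eq_integral => t /set_mem It.
under eq_integral do rewrite pE1.
rewrite (integral_cond_density_pos (dens It) (ce It))// unlock.
rewrite integral_mkcond; apply: eq_integral => w _; rewrite patchE/= indicE.
have -> : (w \in X t @^-1` B) = (w \in [set w' | (`|X t w' - u| <= delta)%R]).
  by apply/idP/idP => /set_mem h; apply/mem_set; move: h; rewrite /B /= in_itv/= ler_distl.
by case: (_ \in _); rewrite ?mulr1 ?mulr0.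
Qed.

End second_limit.

Unset Implicit Arguments.

(* X is indexed by R, but only the variables X t with t in I matter. *)
Theorem theorem7p1 (R : realType) (d : measure_display) (T : measurableType d)
    (P : probability T R) (I : set R) (X : R -> {RV P >-> R})
    (p : R -> R -> R) (u eps : R) :
  is_interval I -> bounded_set I ->
  (0 < eps)%R ->
  (* (a) *)
  (forall w, C1_on I (fun t => X t w)) ->
  (* (b) *)
  ereal_sup [set \int[P]_w (process_crossings I X v w ^+ 2)
            | v in [set v | (`|v - u| < eps)%R]] < +oo ->
  (* (c) *)
  (forall t, I t -> has_density (X t) (p t)) ->
  (exists M : R, forall t v, I t -> (`|v - u| < eps)%R -> (p t v <= M)%R) ->
  (((2 * delta)^-1)%R%:E *
     \int[@lebesgue_measure R]_(t in I)
       'E_P[fun w => `|process_derive I X t w|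
                     * \1_[set w' | (`|X t w' - u| <= delta)%R] w]%R
     @[delta --> 0^'+]
   --> \int[P]_w process_crossings I X u w)
  /\
  (forall e : R -> R -> R,
     (forall t, I t ->
        P.-integrable setT (fun w => (process_derive I X t w)%:E)) ->
     (forall t, I t ->
        is_cond_expectation (fun w => `|process_derive I X t w|%R)
                            (X t) (e t)) ->
     (* the integrand of R(v) is jointly measurable in t and v *)
     measurable_fun (I `*` [set v | (`|v - u| < eps)%R])
       (fun tv : R * R => (e tv.1 tv.2 * p tv.1 tv.2)%R) ->
     ((2 * delta)^-1)%R%:E *
       \int[@lebesgue_measure R]_(v in `[(u - delta)%R, (u + delta)%R]%classic)
         rice_function I p e v
       @[delta --> 0^'+]
     --> \int[P]_w process_crossings I X u w).
Proof.
move=> iI bI eps0 XI sup2 dens [M pM].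
have [a [b [sub1 sub2]]] := bounded_interval_ends iI bI.
have L : ((2 * delta)^-1)%R%:E *
     \int[@lebesgue_measure R]_(t in I)
       'E_P[fun w => `|process_derive I X t w|
                     * \1_[set w' | (`|X t w' - u| <= delta)%R] w]%R
     @[delta --> 0^'+]
   --> \int[P]_w process_crossings I X u w.
  have [ab|ba] := ltP a b; first exact: (first_limit sub1 sub2 ab eps0 XI sup2 dens pM).
  apply: (first_limit_point dens (a := a)) => t /sub2; rewrite /= in_itv/= => ?.
  by lra.
split=> // e _ ce mep; apply: cvg_trans L; apply: near_eq_cvg.
near=> delta; congr (_ * _).
apply/esym/(integral_rice (measurable_interval sub1 sub2) dens ce mep).
- by near: delta; exact: nbhs_right_gt.
- by near: delta; exact: nbhs_right_lt.
Unshelve. all: by end_near. Qed.
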